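(* Assume the setting and Algorithm SC described in the context, and suppose Assumptions (A1)–(A4) hold. Suppose the step-size sequences satisfy (i) $\sum_{k=1}^{\infty}\alpha_{ij,k}^2<\infty$ and $\sup_{k}\alpha_{ij,k+1}/\alpha_{ij,k}<\infty$ for all $(i,j)\in\mathcal{E}$; (ii) $\sum_{k=1}^{\infty}\beta_{i,k}^2<\infty$ and $\sup_k \beta_{i,k+1}/\beta_{i,k}<\infty$ for all $i\in\mathcal{V}$; (iii) $\sum_{k=1}^{\infty} z_k=\infty$, where $z_k=\min\{\alpha_{ij,k}/k^{\nu_{ij}},\ (i,j)\in\mathcal{E};\ \beta_{i,k},\ i\in\mathcal{V}\}$. Then for every $i\in\mathcal{V}$, $\hat\theta_{i,k}\to\theta$ almost surely as $k\to\infty$.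
   Context: Network: undirected weighted graph with sensor set $\mathcal{V}=\{1,\dots,N\}$, symmetric nonnegative weights $a_{ij}=a_{ji}$, with $a_{ij}>0$ iff $(i,j)\in\mathcal{E}$; the edge set $\mathcal{E}$ is regarded as a set of ordered pairs that is symmetric ($(i,j)\in\mathcal{E}\iff(j,i)\in\mathcal{E}$), $M=|\mathcal{E}|/2$ is the number of undirected edges, and $\mathcal{N}_i=\{j:(i,j)\in\mathcal{E}\}$. The Laplacian is $\mathcal{L}=\mathcal{D}-\mathcal{A}$ with $\mathcal{A}=(a_{ij})$, $\mathcal{D}=\mathrm{diag}(\sum_{j\in\mathcal{N}_i}a_{ij})$; $\lambda_2(\mathcal{L})$ is its second smallest eigenvalue. Observations: unknown $\theta\in\mathbb{R}^n$; sensor $i$ observes $y_{i,k}=H_{i,k}\theta+w_{i,k}$, $k\ge1$, with deterministic $H_{i,k}\in\mathbb{R}^{m_i\times n}$ and noise $w_{i,k}\in\mathbb{R}^{m_i}$. Let $d_{i,k}$ ($i\in\mathcal{V},k\ge1$) be the dithering noises used below, $\mathcal{F}_k=\sigma(w_{i,t},d_{i,t}: i\in\mathcal{V},1\le t\le k)$ and $\mathcal{F}^w_k=\sigma(w_{i,t}: i\in\mathcal{V},1\le t\le k)$. Assumptions. (A1) There is $\bar H>0$ with $\|H_{i,k}\|\le\bar H$ for all $i,k$, and there are a positive integer $p$ and $\delta>0$ with $\frac1p\sum_{t=k}^{k+p-1}\sum_{i=1}^N H_{i,t}^\top H_{i,t}\ge\delta I_n$ for all $k\ge1$. (A2) $\{w_{i,k},\mathcal{F}_k\}$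 is a martingale difference sequence and $\sup_{i,k}\mathbb{E}[\|w_{i,k}\|^\rho\mid\mathcal{F}^w_{k-1}]<\infty$ a.s. for some $\rho>2$. (A3) The graph is connected, i.e. $\mathrm{rank}(\mathcal{L})=N-1$. (A4) The $d_{i,k}$ are i.i.d. with the Laplace distribution $\mathrm{Lap}(0,1)$ (density $f(x)=\frac12e^{-|x|}$, distribution function $F$), mutually independent over all $(i,k)$, and independent of all $w_{j,t}$. Algorithm SC. Inputs: deterministic initial estimates $\hat\theta_{i,0}\in\mathbb{R}^n$; event-triggered coefficients $\nu_{ij}=\nu_{ji}\ge0$; noise coefficients $b_{ij}=b_{ji}>0$; step sizes $\alpha_{ij,k}=\alpha_{ji,k}>0$ ($(i,j)\in\mathcal{E}$) and $\beta_{i,k}>0$. For $k=1,2,\dots$: let $\varphi_k\in\mathbb{R}^n$ be the $l$-th standard basis vector, where $k=nq+l$ with $q\in\mathbb{N}\cup\{0\}$, $l\in\{1,\dots,n\}$; set $x_{i,k}=\varphi_k^\top\hat\theta_{i,k-1}$; set $C_{ij,k}=\nu_{ij}b_{ij}\ln k$; set $s_{ij,k}=1$ if $x_{i,k}+b_{ij}d_{i,k}>0$ and $s_{ij,k}=-1$ otherwise. Sensor $i$ sends the one-bit message $s_{ij,k}$ to neighbor $j$ iff $|x_{i,k}+b_{ij}d_{i,k}|>C_{ij,k}$; sensor $i$ sets $\hat s_{ji,k}=s_{ji,k}$ if it received $s_{ji,k}$ from $j$, and $\hat s_{ji,k}=0$ otherwise. With $G_{ij,k}(x)=F((x-C_{ij,k})/b_{ij})-F((-x-C_{ij,k})/b_{ij})$,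 update $\check\theta_{i,k}=\hat\theta_{i,k-1}+\varphi_k\sum_{j\in\mathcal{N}_i}\alpha_{ij,k}a_{ij}(\hat s_{ji,k}-G_{ij,k}(x_{i,k}))$, $\hat\theta_{i,k}=\check\theta_{i,k}+\beta_{i,k}H_{i,k}^\top(y_{i,k}-H_{i,k}\hat\theta_{i,k-1})$. Write $\tilde\theta_{i,k}=\hat\theta_{i,k}-\theta$. *)

(* Defs.v *)
From HB Require Import structures.
From mathcomp Require Import all_boot all_order all_algebra.
From mathcomp Require Import all_classical all_reals all_analysis measurable_realfun.
Set Implicit Arguments. Unset Strict Implicit. Unset Printing Implicit Defensive.
Import Order.TTheory GRing.Theory Num.Theory.
Import numFieldNormedType.Exports.
Local Open Scope classical_set_scope.
Local Open Scope ring_scope.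

Section Defs.
Context {R : realType}.

Definition vnorm {n : nat} (v : 'cV[R]_n) : R :=
  Num.sqrt (\sum_(r < n) v r 0 ^+ 2).

Definition opnorm_le {m n : nat} (M : 'M[R]_(m, n)) (c : R) : Prop :=
  forall x : 'cV[R]_n, vnorm (M *m x) <= c * vnorm x.

Definition loewner_ge {n : nat} (A B : 'M[R]_n) : Prop :=
  forall x : 'cV[R]_n, 0 <= (x^T *m (A - B) *m x) 0 0.

Definition laplacian {N : nat} (a : 'M[R]_N) : 'M[R]_N :=
  \matrix_(i, j) ((i == j)%:R * (\sum_(l | 0 < a i l) a i l) - a i j).

Definition lap_pdf (x : R) : R := 2^-1 * expR (- `|x|).
Definition lap_cdf (x : R) : R :=
  if x < 0 then 2^-1 * expR x else 1 - 2^-1 * expR (- x).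

(* phi_k = l-th standard basis vector, k = n q + l, 1 <= l <= n
   (i.e. the coordinate (k-1) mod n, 0-based). *)
Definition phi (n k : nat) : 'cV[R]_n := \col_(r < n) ((r : nat) == (k.-1 %% n)%N)%:R.

Definition sc_step (N n : nat) (m : 'I_N -> nat)
  (a : 'M[R]_N) (nu b : 'I_N -> 'I_N -> R)
  (alpha : 'I_N -> 'I_N -> nat -> R) (beta : 'I_N -> nat -> R)
  (H : forall i : 'I_N, nat -> 'M[R]_(m i, n)) (theta : 'cV[R]_n)
  (wk : forall i : 'I_N, 'cV[R]_(m i)) (dk : 'I_N -> R)
  (k : nat) (prev : 'I_N -> 'cV[R]_n) : 'I_N -> 'cV[R]_n :=
  fun i =>
  let x := fun l : 'I_N => ((phi n k)^T *m prev l) 0 0 in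
  let C := fun l j : 'I_N => nu l j * b l j * ln (k%:R) in
  let s := fun l j : 'I_N => if 0 < x l + b l j * dk l then 1 else -1 : R in
  (* hat s_{ji,k} as received by sensor i from neighbour j *)
  let shat := fun j l : 'I_N =>
    if C j l < `|x j + b j l * dk j| then s j l else 0 in
  let G := fun l j : 'I_N => fun z : R =>
    lap_cdf ((z - C l j) / b l j) - lap_cdf ((- z - C l j) / b l j) in
  let y := H i k *m theta + wk i in
  let check := prev i + (\sum_(j | 0 < a i j)
        alpha i j k * a i j * (shat j i - G i j (x i))) *: phi n k in
  check + beta i k *: ((H i k)^T *m (y - H i k *m prev i)).

Fixpoint sc_est (N n : nat) (m : 'I_N -> nat)
  (a : 'M[R]_N) (nu b : 'I_N -> 'I_N -> R)
  (alpha : 'I_N -> 'I_N -> nat -> R) (beta : 'I_N -> nat -> R)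
  (H : forall i : 'I_N, nat -> 'M[R]_(m i, n)) (theta : 'cV[R]_n)
  (theta0 : 'I_N -> 'cV[R]_n) {T : Type}
  (w : forall i : 'I_N, nat -> T -> 'cV[R]_(m i)) (d : 'I_N -> nat -> T -> R)
  (k : nat) (om : T) : 'I_N -> 'cV[R]_n :=
  match k with
  | 0 => theta0
  | k'.+1 => sc_step a nu b alpha beta H theta (fun i => w i k'.+1 om)
               (fun i => d i k'.+1 om) k'.+1
               (sc_est a nu b alpha beta H theta theta0 w d k' om)
  end.

(* Generators of F_k = sigma(w_{i,t}, d_{i,t} : i, 1 <= t <= k) and of
   F^w_k = sigma(w_{i,t} : i, 1 <= t <= k). *)
Definition gen_w {N : nat} {m : 'I_N -> nat} {T : Type}
  (w : forall i : 'I_N, nat -> T -> 'cV[R]_(m i)) (k : nat) : set (set T) :=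
  [set A | exists i t (c : 'I_(m i)) (B : set R),
      (1 <= t <= k)%N /\ measurable B /\ A = (fun om => w i t om c 0) @^-1` B].

Definition gen_d {N : nat} {T : Type} (d : 'I_N -> nat -> T -> R) (k : nat)
  : set (set T) :=
  [set A | exists i t (B : set R),
      (1 <= t <= k)%N /\ measurable B /\ A = d i t @^-1` B].

Definition gen_w_all {N : nat} {m : 'I_N -> nat} {T : Type}
  (w : forall i : 'I_N, nat -> T -> 'cV[R]_(m i)) : set (set T) :=
  \bigcup_(k in setT) gen_w w k.

End Defs.

(* Main.v *)
Require Import Defs.
From HB Require Import structures.
From mathcomp Require Import all_boot all_order all_algebra.
From mathcomp Require Import all_classical all_reals all_analysis measurable_realfun.
From mathcomp Require Import ring lra.
Import Order.TTheory GRing.Theory Num.Theory.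
Import numFieldNormedType.Exports.
Local Open Scope classical_set_scope.
Local Open Scope ring_scope.
Set Implicit Arguments. Unset Strict Implicit. Unset Printing Implicit Defensive.

(** The Lyapunov function is [V = sum_i |theta_i - theta|^2], where [theta_i] is the estimate
    of sensor [i].  One step of the algorithm gives [V' <= V - D + 2 m + r (1 + V)], where
    [D >= 0] collects the consensus and observation terms, [m] is a martingale difference
    and [r] is summable.  Since [m / (1 + V)] has uniformly bounded predictable weights, its
    series converges almost surely without any a priori bound on [V]; comparing [ln (1 + V)]
    with this series shows pathwise that [V] converges and that [D] is summable.  On bounded
    sets the averaged one-bit message has slope at least a constant times [k^(-nu)], so
    summability of [D] controls [sum_k z_k E_k], where the quadratic form [E_k], summed over
    a window of [n + p] steps, dominates [V] up to vanishing increments (connectivity of the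
    graph and persistent excitation).  As [sum_k z_k] diverges, the limit of [V] is [0]. *)

(** * Laplace noise and the dithered quantizer *)

Section LaplaceDistribution.
Context (R : realType).
Implicit Types x y K : R.

Lemma lap_cdfN x : lap_cdf (- x) = 1 - lap_cdf x.
Proof.
rewrite /lap_cdf oppr_lt0 opprK; case: ltgtP => [x0|x0|<-]; try lra.
by rewrite oppr0 expR0; lra.
Qed.

Lemma lap_cdf_nnegE x : 0 <= x -> lap_cdf x = 1 - 2^-1 * expR (- x).
Proof. by rewrite /lap_cdf ltNge => ->. Qed.

Lemma lap_cdf0 : lap_cdf (0 : R) = 2^-1.
Proof. by rewrite lap_cdf_nnegE// oppr0 expR0; lra. Qed.

Lemma expR_secant x y : x <= y -> expR x * (y - x) <= expR y - expR x <= expR y * (y - x).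
Proof.
move=> xy; have tangent_x := expR_ge1Dx (y - x); have tangent_y := expR_ge1Dx (x - y).
have eyE : expR x * expR (y - x) = expR y by rewrite -expRD subrKC.
have exE : expR y * expR (x - y) = expR x by rewrite -expRD subrKC.
by have := expR_gt0 x; have := expR_gt0 y; nra.
Qed.

Lemma lap_cdf_increment K x y : - K <= x -> x <= y -> y <= K ->
  2^-1 * expR (- K) * (y - x) <= lap_cdf y - lap_cdf x <= y - x.
Proof.
move=> Kx xy yK; set s := 2^-1 * expR (- K).
have pos u v : 0 <= u -> u <= v -> v <= K -> s * (v - u) <= lap_cdf v - lap_cdf u <= v - u.
  move=> u0 uv vK; rewrite !lap_cdf_nnegE ?(le_trans u0)//.
  have := @expR_secant (- v) (- u); rewrite lerN2 => /(_ uv).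
  have : expR (- K) <= expR (- v) by rewrite ler_expR lerN2.
  have : expR (- u) <= 1 by rewrite -expR0 ler_expR oppr_le0.
  by have := expR_gt0 (- K); rewrite /s; nra.
have [x0|x0] := leP 0 x; first exact: pos.
have [y0|y0] := leP 0 y.
  have := pos 0 y (lexx _) y0; have := pos 0 (- x) (lexx _).
  by rewrite lap_cdfN lap_cdf0; lra.
by have := pos (- y) (- x); rewrite !lap_cdfN; lra.
Qed.

Lemma lap_cdf_lip x y : x <= y -> 0 <= lap_cdf y - lap_cdf x <= y - x.
Proof.
move=> xy; have Kx : `|x| <= `|x| + `|y| by rewrite lerDl.
have Ky : `|y| <= `|x| + `|y| by rewrite lerDr.
move: Kx Ky; rewrite !ler_norml => /andP[Kx _] /andP[_ yK].
have /andP[lb ->] := lap_cdf_increment Kx xy yK; rewrite andbT.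
by apply: le_trans lb; rewrite !mulr_ge0 ?expR_ge0// subr_ge0.
Qed.

Lemma lap_cdf_ge0 x : 0 <= lap_cdf x.
Proof.
rewrite /lap_cdf; case: ltP => x0; first by rewrite mulr_ge0 ?expR_ge0.
have : expR (- x) <= 1 by rewrite -expR0 ler_expR oppr_le0.
lra.
Qed.

Lemma lap_cdf_le1 x : lap_cdf x <= 1.
Proof. by have := lap_cdf_ge0 (- x); rewrite lap_cdfN; lra. Qed.

Lemma measurable_lap_cdf : measurable_fun setT (@lap_cdf R).
Proof.
apply: measurable_fun_ifT; first exact: measurable_fun_ltr.
  by apply: measurable_funM => //; exact: measurable_expR.
apply: measurable_funB => //; apply: measurable_funM => //.
by apply: measurableT_comp.
Qed.

End LaplaceDistribution.

Section Quantizer.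
Context (R : realType).
Implicit Types c b x y z K : R.

Definition quantized c z : R := if c < `|z| then (if 0 < z then 1 else -1) else 0.

(* The function [G] of the algorithm: the mean of [quantized c (z + b D)] for [D] Laplace. *)
Definition mean_quantized c b z : R := lap_cdf ((z - c) / b) - lap_cdf ((- z - c) / b).

Lemma norm_quantized_le1 c z : `|quantized c z| <= 1.
Proof. by rewrite /quantized; do 2?case: ifP => _; rewrite ?normrN ?normr1 ?normr0. Qed.

Lemma quantizedE c z : 0 <= c -> quantized c z = (c < z)%R%:R - (z < - c)%R%:R.
Proof.
move=> c0; rewrite /quantized ltr_normr ltrNr; have [cz|zc] := ltP c z.
  have -> : (z < - c) = false by apply/negbTE; rewrite -leNgt; lra.
  by rewrite (le_lt_trans c0 cz) subr0.
have [zNc|_] := ltP z (- c); last by rewrite subrr.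
have -> : (0 < z) = false by apply/negbTE; rewrite -leNgt; lra.
by rewrite sub0r.
Qed.

Lemma norm_mean_quantized_le1 c b z : `|mean_quantized c b z| <= 1.
Proof.
have F01 u := conj (@lap_cdf_ge0 R u) (lap_cdf_le1 u).
by rewrite ler_norml /mean_quantized; have := F01 ((z - c) / b); have := F01 ((- z - c) / b); lra.
Qed.

Lemma mean_quantized_slope c b K x y : 0 < b -> 0 <= c -> `|x| <= K -> `|y| <= K ->
  2^-1 * expR (- ((K + c) / b)) / b * (x - y) ^+ 2 <=
    (x - y) * (mean_quantized c b x - mean_quantized c b y).
Proof.
move=> b0 c0; wlog xy : x y / y <= x => [sym xK yK|].
  have [|/ltW yx] := leP y x; first by move=> /sym; apply.
  rewrite -sqrrN opprB (le_trans (sym _ _ yx yK xK))//.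
  by rewrite -mulrNN !opprB.
rewrite !ler_norml => /andP[Kx xK] /andP[Ky yK]; have bV : 0 < b^-1 by rewrite invr_gt0.
have := @lap_cdf_increment R ((K + c) / b) ((y - c) / b) ((x - c) / b).
rewrite -mulNr !ler_pM2r// => /(_ ltac:(lra) ltac:(lra) ltac:(lra)) /andP[incr _].
have := @lap_cdf_lip R ((- x - c) / b) ((- y - c) / b).
rewrite ler_pM2r// => /(_ ltac:(lra)) /andP[decr _].
rewrite expr2 mulrCA ler_wpM2l ?subr_ge0//.
apply: le_trans (_ : _ <= lap_cdf ((x - c) / b) - lap_cdf ((y - c) / b)) _.
  by apply: le_trans incr; rewrite -mulrBl; set e := expR _; lra.
by rewrite /mean_quantized; lra.
Qed.

Lemma mean_quantized_monotone c b x y : 0 < b -> 0 <= c ->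
  0 <= (x - y) * (mean_quantized c b x - mean_quantized c b y).
Proof.
move=> b0 c0; have Kx : `|x| <= `|x| + `|y| by rewrite lerDl.
have Ky : `|y| <= `|x| + `|y| by rewrite lerDr.
apply: le_trans (mean_quantized_slope b0 c0 Kx Ky).
by rewrite mulr_ge0 ?sqr_ge0// divr_ge0 ?ltW// mulr_gt0 ?expR_gt0.
Qed.

Lemma measurable_quantized c : measurable_fun setT (quantized c).
Proof.
apply: measurable_fun_ifT => //; first by apply: measurable_fun_ltr => //; exact: measurableT_comp.
by apply: measurable_fun_ifT => //; exact: measurable_fun_ltr.
Qed.

Lemma measurable_mean_quantized c b : measurable_fun setT (mean_quantized c b).
Proof.
apply: measurable_funB; apply: measurableT_comp (@measurable_lap_cdf R) _.
  by apply: measurable_funM => //; exact: measurable_funB.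
by apply: measurable_funM => //; exact: measurable_funB.
Qed.

End Quantizer.

(** * Almost sure convergence of martingale series *)

Section Series.
Context (R : realType).
Implicit Types u v : nat -> R.

Lemma le_series_limn u k : (forall k, 0 <= u k) -> cvgn (series u) -> series u k <= limn (series u).
Proof.
by move=> u0 cu; apply: nondecreasing_cvgn_le => //; apply: nondecreasing_series => n _ _.
Qed.

Lemma bounded_series_cvg u B : (forall k, 0 <= u k) -> (forall k, series u k <= B) ->
  cvgn (series u).
Proof.
move=> u0 uB; apply: nondecreasing_is_cvgn; first by apply: nondecreasing_series => n _ _.
by exists B => _ [k _ <-].
Qed.

Lemma cvg_seriesM c u : cvgn (series u) -> cvgn (series (fun k => c * u k)).
Proof. exact: is_cvg_seriesZ. Qed.

Lemma cvg_series0 u : (forall k, u k = 0) -> cvgn (series u).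
Proof.
move=> u0; rewrite (_ : series u = cst 0); first exact: is_cvg_cst.
by apply/funext => k; rewrite /series/= big1.
Qed.

Lemma cvg_series_sum (I : Type) (r : seq I) (u : I -> nat -> R) :
  (forall i, cvgn (series (u i))) -> cvgn (series (fun k => \sum_(i <- r) u i k)).
Proof.
move=> cu; elim: r => [|i r IH]; first by apply: cvg_series0 => k; rewrite big_nil.
rewrite (_ : (fun k => _) = u i + (fun k => \sum_(j <- r) u j k)); first exact: is_cvg_seriesD.
by apply/funext => k; rewrite big_cons.
Qed.

Lemma series_shift u n k : series (fun t => u (t + n)%N) k = series u (k + n)%N - series u n.
Proof.
by rewrite sub_series leq_addl /series/= -{2}[n]add0n big_addn addnK.
Qed.

Lemma cvg_series_shift u n : cvgn (series (fun t => u (t + n)%N)) <-> cvgn (series u).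
Proof.
have -> : series (fun t => u (t + n)%N) = (fun k => series u (k + n)%N - series u n).
  by apply/funext => k; exact: series_shift.
split=> [cu|/cvg_ex[l ul]]; last first.
  by apply: is_cvgB; [apply/cvg_ex; exists l; rewrite cvg_shiftn|exact: is_cvg_cst].
have /cvg_ex[l] : cvgn (fun k => series u (k + n)%N).
  rewrite (_ : (fun k => _) = (fun k => series u (k + n)%N - series u n) \+ cst (series u n)).
    by apply: is_cvgD => //; exact: is_cvg_cst.
  by apply/funext => k; rewrite /= subrK.
by rewrite cvg_shiftn => /cvgP.
Qed.

Lemma series_tail_le u e : (forall k, 0 <= u k) -> cvgn (series u) -> 0 < e ->
  exists n, forall k, series (fun t => u (t + n)%N) k <= e.
Proof.
move=> u0 cu e0; have /cvgrPdist_lt/(_ _ e0)[n _ /(_ n (leqnn n))/=] := cu.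
rewrite ltr_norml => /andP[_ un]; exists n => k; rewrite series_shift.
by have := le_series_limn (k + n)%N u0 cu; lra.
Qed.

Lemma eseries_from1 (f : nat -> \bar R) :
  (\sum_(1 <= k <oo) f k = \sum_(k <oo) f k.+1)%E.
Proof.
congr (get _); apply/funext => l; rewrite -[LHS]cvg_shiftS /=.
by under eq_fun do rewrite big_add1.
Qed.

Lemma nneseriesE u : cvgn (series u) ->
  (\sum_(k <oo) (u k)%:E = (limn (series u))%:E)%E.
Proof.
move=> cu; rewrite -EFin_lim//; congr (limn _); apply/funext => n /=.
by rewrite sumEFin.
Qed.

Lemma nneseries_from1_cvg u : (forall k, 0 <= u k) ->
  (\sum_(1 <= k <oo) (u k)%:E < +oo)%E -> cvgn (series (fun k => u k.+1)).
Proof. by move=> u0; rewrite eseries_from1; exact: nnseries_is_cvg. Qed.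

End Series.

Lemma bounded_integrable (d : measure_display) (T : measurableType d) (R : realType)
    (P : probability T R) (f : T -> R) (C : R) :
  measurable_fun setT f -> (forall x, `|f x| <= C) -> P.-integrable setT (EFin \o f).
Proof.
move=> mf fC; apply: measurable_bounded_integrable => //.
  exact: le_lt_trans (probability_le1 P measurableT) (ltry 1).
exists C; split; first exact: num_real.
by move=> M CM x _; exact: le_trans (fC x) (ltW CM).
Qed.

Lemma measurable_fun_posV (d : measure_display) (T : measurableType d) (R : realType)
    (f : T -> R) : measurable_fun setT f -> (forall x, 0 < f x) ->
  measurable_fun setT (fun x => (f x)^-1).
Proof.
move=> mf f0; rewrite (_ : (fun x => _) = (fun x => f x `^ (-1))).
  exact: (measurableT_comp (measurable_powR (-1)) mf).
by apply/funext => x; rewrite powR_inv1// ltW.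
Qed.

Section ConditionallyCentered.
Import HBNNSimple.
Context (d : measure_display) (T : measurableType d) (R : realType).
Context (P : {measure set T -> \bar R}).
Implicit Types (G : set (set T)) (f X Y : T -> R).

Definition measurable_wrt G f := measurable_fun setT (f : g_sigma_algebraType G -> R).

Definition centered_given G X := forall A, <<s G >> A -> (\int[P]_(x in A) (X x)%:E = 0)%E.

Lemma sub_g_sigma G : G `<=` measurable -> <<s G >> `<=` measurable.
Proof. by move=> sG; apply: smallest_sub => //; exact: sigma_algebra_measurable. Qed.

Lemma measurable_wrt_fun G f : G `<=` measurable -> measurable_wrt G f -> measurable_fun setT f.
Proof. by move=> sG mf _ B mB; apply: (sub_g_sigma sG); exact: mf. Qed.

Lemma measurable_wrtS G G' f : <<s G >> `<=` <<s G' >> -> measurable_wrt G f -> measurable_wrt G' f.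
Proof. by move=> sGG' mf _ B mB; apply: sGG'; exact: mf. Qed.

Lemma measurable_wrt_indic G A : <<s G >> A -> measurable_wrt G \1_A.
Proof. by move=> GA; exact: (@measurable_indic _ (g_sigma_algebraType G)). Qed.

Lemma integrable_bounded_mul X Y (C : R) : measurable_fun setT Y -> (forall x, `|Y x| <= C) ->
  P.-integrable setT (EFin \o X) -> P.-integrable setT (fun x => (Y x * X x)%:E).
Proof.
move=> mY YC; apply: integrableMr => //; exists C; split; first exact: num_real.
by move=> M CM x _; exact: le_trans (YC x) (ltW CM).
Qed.

Context (G : set (set T)) (sG : G `<=` measurable).

Let centered_simple_weight X (h : {nnsfun g_sigma_algebraType G >-> R}) :
  P.-integrable setT (EFin \o X) -> centered_given G X -> (\int[P]_x (h x * X x)%:E = 0)%E.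
Proof.
move=> iX X0; pose level y : set T := h @^-1` [set y].
have mlevel y : <<s G >> (level y) by have := measurable_funPTI h (measurable_set1 y).
have ilevel y : P.-integrable setT (fun x => (\1_(level y) x * X x)%:E).
  apply: (@integrable_bounded_mul _ _ 1) => //.
    by apply: measurable_indic; exact: (sub_g_sigma sG).
  by move=> x; rewrite indicE; case: (_ \in _); rewrite ?normr1 ?normr0.
transitivity (\int[P]_x (\sum_(y <- finmap.enum_fset (fset_set (range h)))
    (y%:E * (\1_(level y) x * X x)%:E)))%E.
  apply: eq_integral => x _; rewrite (fimfunE h x) fsbig_finite//= mulr_suml -sumEFin.
  by apply: eq_bigr => y _; rewrite -mulrA EFinM.
rewrite integral_sum//; last by move=> y; exact: integrableZl.
rewrite big1// => y _; rewrite integralZl//.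
have := X0 _ (mlevel y); rewrite integral_mkcond epatch_indic => level0.
under eq_integral do rewrite EFinM muleC.
by rewrite level0 mule0.
Qed.

Let centered_ge0_weight X Y (C : R) : P.-integrable setT (EFin \o X) -> centered_given G X ->
  measurable_wrt G Y -> (forall x, 0 <= Y x <= C) -> (\int[P]_x (Y x * X x)%:E = 0)%E.
Proof.
move=> iX X0 mY YC.
have mX : measurable_fun setT X by apply/measurable_EFinP; exact: measurable_int iX.
have mEY : measurable_fun setT (EFin \o Y : g_sigma_algebraType G -> \bar R).
  exact/measurable_EFinP.
pose h := nnsfun_approx measurableT mEY.
have cvg_h x : (EFin \o h ^~ x) n @[n --> \oo] --> (Y x)%:E.
  by apply: cvg_nnsfun_approx => // y _; rewrite lee_fin; case/andP: (YC y).
have le_hY n x : h n x <= Y x.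
  rewrite -lee_fin -(cvg_lim _ (cvg_h x))//.
  apply: lime_ge; first by apply/cvg_ex; exists (Y x)%:E.
  by exists n => // j /= nj; rewrite lee_fin; exact/lefP/nd_nnsfun_approx.
have mh n : measurable_fun setT (h n : T -> R).
  by apply: (measurable_wrt_fun sG); exact: measurable_funP.
have : (\int[P]_x (h n x * X x)%:E)%E @[n --> \oo] --> (\int[P]_x (Y x * X x)%:E)%E.
  apply: (@dominated_cvg _ _ _ _ _ _ _ _ (fun x => C%:E * `|(X x)%:E|)%E) => //.
  - by move=> n; apply/measurable_EFinP; exact: measurable_funM.
  - move=> x _; under eq_fun do rewrite EFinM.
    by rewrite EFinM; apply: cvgeZr => //; exact: cvg_h.
  - by apply: integrableZl => //; exact: integrable_abse.
  - move=> n x _; rewrite -EFinM/= lee_fin normrM ler_wpM2r// ger0_norm//.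
    by apply: le_trans (le_hY n x) _; case/andP: (YC x).
under eq_fun do rewrite centered_simple_weight//.
by move=> /(cvg_lim (@ereal_hausdorff R)) <-; rewrite lim_cst.
Qed.

Lemma centered_bounded_weight X Y (C : R) : P.-integrable setT (EFin \o X) ->
  centered_given G X -> measurable_wrt G Y -> (forall x, `|Y x| <= C) ->
  centered_given G (fun x => Y x * X x).
Proof.
move=> iX X0 mY YC A GA; pose Z x : R := \1_A x * Y x.
have mZ : measurable_wrt G Z by apply: measurable_funM => //; exact: measurable_wrt_indic.
have ZC x : `|Z x| <= C.
  rewrite normrM; apply: le_trans (YC x); rewrite ler_piMl//.
  by rewrite indicE; case: (_ \in _); rewrite ?normr1 ?normr0.
have C0 : 0 <= C := le_trans (normr_ge0 _) (YC point).
have X0T : (\int[P]_x (C * X x)%:E = 0)%E.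
  apply: (@centered_ge0_weight _ (cst C) C) => //; first exact: measurable_cst.
  by move=> x; rewrite C0 lexx.
have ZX0 : (\int[P]_x ((Z x + C) * X x)%:E = 0)%E.
  apply: (@centered_ge0_weight _ (fun x => Z x + C) (C + C)) => //.
    exact: measurable_funD.
  by move=> x; move: (ZC x); rewrite ler_norml; lra.
rewrite integral_mkcond.
transitivity (\int[P]_x (((Z x + C) * X x)%:E - (C * X x)%:E))%E.
  apply: eq_integral => x _; rewrite -EFinB mulrDl addrK /Z patchE indicE.
  by case: (x \in A); rewrite ?mul1r ?mul0r.
rewrite integralB_EFin ?ZX0 ?X0T ?subee//.
- apply: (@integrable_bounded_mul _ _ (C + C)) => //.
    by apply: measurable_funD => //; exact: measurable_wrt_fun mZ.
  by move=> x; rewrite (le_trans (ler_normD _ _))// lerD// ger0_norm.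
- by apply: (@integrable_bounded_mul _ (cst C) C) => // x; rewrite ger0_norm.
Qed.

End ConditionallyCentered.

Section MaximalInequality.
Context (d : measure_display) (T : measurableType d) (R : realType) (P : probability T R).
Context (F : nat -> set (set T)) (sF : forall k, F k `<=` measurable).
Context (ndF : forall k, <<s F k >> `<=` <<s F k.+1 >>).
Context (X : nat -> T -> R) (mX : forall k, measurable_wrt (F k.+1) (X k)).
Context (X0 : forall k, centered_given P (F k) (X k)).
Context (v : nat -> R) (X2 : forall k, (\int[P]_x (X k x ^+ 2)%:E <= (v k)%:E)%E).

(* The partial sums of [X] frozen when they leave [-e, e]: the cross terms in
   their second moments then have bounded predictable weights. *)
Fixpoint stopped_sum (e : R) (k : nat) (x : T) : R :=
  if k is k'.+1 then
    (if `|stopped_sum e k' x| <= e then stopped_sum e k' x + X k' x else stopped_sum e k' x)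
  else 0.

Lemma measurable_stopped_sum e k : measurable_wrt (F k) (stopped_sum e k).
Proof.
elim: k => [|k IH]; first exact: measurable_cst.
have IHS := measurable_wrtS (@ndF k) IH.
apply: measurable_fun_ifT => //.
  by apply: measurable_fun_ler => //; exact: measurableT_comp.
by apply: measurable_funD => //; exact: mX.
Qed.

Let mXT k : measurable_fun setT (X k).
Proof. exact: measurable_wrt_fun (@sF _) (@mX k). Qed.

Let mST e k : measurable_fun setT (stopped_sum e k).
Proof. by apply: measurable_wrt_fun (@sF k) _; exact: measurable_stopped_sum. Qed.

Let integrable_sqr k : P.-integrable setT (fun x => (X k x ^+ 2)%:E).
Proof.
apply/integrableP; split; first by apply/measurable_EFinP; apply: measurable_funX; exact: mXT.
apply: le_lt_trans (ltry (v k)).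
under eq_integral do rewrite gee0_abs ?lee_fin ?sqr_ge0//.
exact: X2.
Qed.

Let integrableX k : P.-integrable setT (EFin \o X k).
Proof.
apply: (@le_integrable _ _ _ _ _ measurableT _ (fun x => (1 + X k x ^+ 2)%:E)).
- exact/measurable_EFinP.
- move=> x _ /=; rewrite lee_fin [leRHS]ger0_norm ?addr_ge0 ?sqr_ge0//.
  by rewrite ler_norml; have := sqr_ge0 (X k x - 1); have := sqr_ge0 (X k x + 1); nra.
- under eq_fun do rewrite EFinD.
  by apply: integrableD => //; exact: finite_measure_integrable_cst.
Qed.

Let running e k x : R := (`|stopped_sum e k x| <= e)%R%:R.

Let measurable_running e k : measurable_wrt (F k) (running e k).
Proof.
rewrite /running (_ : (fun x => _) = fun x => if `|stopped_sum e k x| <= e then 1 else 0).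
  apply: measurable_fun_ifT => //; apply: measurable_fun_ler => //.
  by apply: measurableT_comp => //; exact: measurable_stopped_sum.
by apply/funext => x; case: ifP.
Qed.

Let running_le1 e k x : `|running e k x| <= 1.
Proof. by rewrite /running; case: (_ <= e); rewrite ?normr1 ?normr0. Qed.

Let stopped_sum_sqrS e k x : stopped_sum e k.+1 x ^+ 2 =
  stopped_sum e k x ^+ 2 + 2 * (running e k x * stopped_sum e k x) * X k x +
  running e k x * X k x ^+ 2.
Proof. by rewrite /running /=; case: (_ <= e) => /=; ring. Qed.

Lemma stopped_sum_second_moment e k :
  P.-integrable setT (fun x => (stopped_sum e k x ^+ 2)%:E) /\
  (\int[P]_x (stopped_sum e k x ^+ 2)%:E <= (series v k)%:E)%E.
Proof.
elim: k => [|k [iS S2]].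
  rewrite /series/= big_geq//; under eq_fun do rewrite expr0n/=.
  by split; [exact: integrable0|rewrite integral0].
pose weight x := 2 * (running e k x * stopped_sum e k x).
have mweight : measurable_wrt (F k) weight.
  apply: measurable_funM => //; apply: measurable_funM; first exact: measurable_running.
  exact: measurable_stopped_sum.
have weight_le x : `|weight x| <= 2 * `|e|.
  rewrite /weight normrM (ger0_norm (ler0n R 2)) ler_wpM2l// /running.
  case: (boolP (_ <= e)) => [le_e|_]; rewrite ?mul0r ?normr0// mul1r.
  exact: le_trans (ler_norm e).
have icross : P.-integrable setT (fun x => (weight x * X k x)%:E).
  by apply: integrable_bounded_mul weight_le _ => //; exact: measurable_wrt_fun (@sF _) mweight.
have idiag : P.-integrable setT (fun x => (running e k x * X k x ^+ 2)%:E).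
  apply: (integrable_bounded_mul (X := fun x => X k x ^+ 2)) (running_le1 e k) _.
    by apply: measurable_wrt_fun (@sF k) _; exact: measurable_running.
  exact: integrable_sqr.
have cross0 : (\int[P]_x (weight x * X k x)%:E = 0)%E.
  apply: (centered_bounded_weight (@sF k) (integrableX k) (@X0 k) mweight weight_le).
  exact: (@measurableT _ (g_sigma_algebraType (F k))).
under eq_fun do rewrite stopped_sum_sqrS !EFinD.
split; first by apply: integrableD => //; exact: integrableD.
rewrite integralD//; last exact: integrableD.
rewrite integralD// cross0 adde0 seriesSr EFinD; apply: leeD => //.
apply: le_trans (X2 k); apply: le_integral => // x _.
by rewrite lee_fin ler_piMl ?sqr_ge0//; exact: le_trans (ler_norm _) (running_le1 e k x).
Qed.

Let measurable_exit e k : measurable [set x | e < `|stopped_sum e k x|].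
Proof.
have : measurable_fun setT (fun x => e < `|stopped_sum e k x|).
  by apply: measurable_fun_ltr => //; apply: measurableT_comp => //; exact: mST.
by move=> /(_ measurableT [set true] I); rewrite setTI.
Qed.

Lemma stopped_sum_exit_prob e k : 0 < e ->
  (P [set x | (e < `|stopped_sum e k x|)%R] <= (e ^- 2 * series v k)%:E)%E.
Proof.
move=> e0; have [iS S2] := stopped_sum_second_moment e k.
have e20 : 0 < e ^+ 2 by rewrite exprn_gt0.
have := le_integral_abse P measurableT (measurable_int _ iS) e20; rewrite setTI.
under [X in (_ <= X)%E -> _]eq_integral do rewrite gee0_abs ?lee_fin ?sqr_ge0//.
move=> /le_trans/(_ S2) chebyshev_ineq.
rewrite EFinM -lee_pdivrMl ?invr_gt0// invrK; apply: le_trans chebyshev_ineq.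
apply: lee_wpmul2l; first by rewrite lee_fin ltW.
apply: le_measure; rewrite ?inE; first exact: measurable_exit.
  have : measurable_fun setT (fun x => ((e ^+ 2)%:E <= `|(stopped_sum e k x ^+ 2)%:E|)%E).
    by apply: measurable_fun_lee => //; apply: measurableT_comp => //; exact: measurable_int iS.
  by move=> /(_ measurableT [set true] I); rewrite setTI.
move=> x /= ex; rewrite lee_fin ger0_norm ?sqr_ge0// -(real_normK (num_real (stopped_sum e k x))).
by rewrite lerXn2r ?nnegrE ?normr_ge0 ?ltW.
Qed.

Lemma stopped_sumE e k x : (forall t, (t < k)%N -> `|stopped_sum e t x| <= e) ->
  stopped_sum e k x = series (X ^~ x) k.
Proof.
elim: k => [|k IH] stay; first by rewrite /series/= big_geq.
by rewrite seriesSr /= stay// IH// => t tk; rewrite stay// ltnW.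
Qed.

Lemma kolmogorov_maximal (e B : R) : 0 < e -> (forall k, series v k <= B) ->
  exists2 E, measurable E &
    (P E <= (e ^- 2 * B)%:E)%E /\ forall k x, e < `|series (X ^~ x) k| -> E x.
Proof.
move=> e0 vB; pose E := \bigcup_k [set x | e < `|stopped_sum e k x|].
have mE : measurable E by apply: bigcup_measurable => k _; exact: measurable_exit.
exists E => //; split.
  have nd : {homo (fun k => [set x | e < `|stopped_sum e k x|]) : i j / (i <= j)%N >-> (i <= j)%O}.
    apply/nondecreasing_seqP => k; apply/subsetPset => x /= ex.
    by rewrite leNgt ex.
  have cP := nondecreasing_cvg_mu (mu := P) (measurable_exit e) mE nd.
  rewrite -(cvg_lim _ cP)//; apply: lime_le; first exact: cvgP cP.
  apply: nearW => k /=; apply: le_trans (stopped_sum_exit_prob k e0) _.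
  by rewrite lee_fin ler_wpM2l// invr_ge0 sqr_ge0.
move=> k x ex; apply: contrapT => never_exits.
have stay t : `|stopped_sum e t x| <= e.
  by rewrite leNgt; apply/negP => et; apply: never_exits; exists t.
by move: ex; rewrite -(@stopped_sumE e)// ltNge stay.
Qed.

End MaximalInequality.

Lemma negligible_small_cover (d : measure_display) (T : measurableType d) (R : realType)
    (mu : {measure set T -> \bar R}) (A : set T) :
  (forall e : R, 0 < e -> exists2 E, measurable E & A `<=` E /\ (mu E <= e%:E)%E) ->
  mu.-negligible A.
Proof.
move=> cover; have /choice[E hE] : forall i, exists E,
    [/\ measurable E, A `<=` E & (mu E <= (i.+1%:R^-1 : R)%:E)%E].
  by move=> i; have [|E mE [AE muE]] := cover i.+1%:R^-1; rewrite ?invr_gt0//; exists E.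
have mE : measurable (\bigcap_i E i) by apply: bigcap_measurableType => i _; case: (hE i).
exists (\bigcap_i E i); split => //; last by move=> x Ax i _; case: (hE i) => _ /(_ x Ax).
apply/eqP; rewrite eq_le measure_ge0 andbT; apply/lee_addgt0Pr => e e0; rewrite add0e.
have [i _ /(_ i (leqnn i)) ie] := near_infty_natSinv_lt (PosNum e0).
have [mEi _ muEi] := hE i; apply: le_trans (le_trans muEi _); last by rewrite lee_fin ltW.
by apply: le_measure; rewrite ?inE// => x; exact.
Qed.

Section MartingaleSeries.
Context (d : measure_display) (T : measurableType d) (R : realType) (P : probability T R).
Context (F : nat -> set (set T)) (sF : forall k, F k `<=` measurable).
Context (ndF : forall k, <<s F k >> `<=` <<s F k.+1 >>).
Context (X : nat -> T -> R) (mX : forall k, measurable_wrt (F k.+1) (X k)).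
Context (X0 : forall k, centered_given P (F k) (X k)).
Context (v : nat -> R) (X2 : forall k, (\int[P]_x (X k x ^+ 2)%:E <= (v k)%:E)%E).
Context (cv : cvgn (series v)).

Let v_ge0 k : 0 <= v k.
Proof.
by rewrite -lee_fin; apply: le_trans (X2 k); apply: integral_ge0 => x _; rewrite lee_fin sqr_ge0.
Qed.

Let negligible_oscillation (e : R) : 0 < e ->
  P.-negligible [set x | forall n, exists k, e < `|series (fun t => X (t + n)%N x) k|].
Proof.
move=> e0; apply: negligible_small_cover => r r0.
have er0 : 0 < e ^+ 2 * r by rewrite mulr_gt0 ?exprn_gt0.
have [n vn] := series_tail_le v_ge0 cv er0.
have [E mE [PE oscE]] := kolmogorov_maximal (F := fun t => F (t + n)%N) (fun t => @sF _)
  (fun t => @ndF _) (fun t => @mX _) (fun t => @X0 _) (fun t => @X2 _) e0 vn.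
exists E => //; split; first by move=> x /(_ n)[k]; exact: oscE.
by apply: le_trans PE _; rewrite lee_fin mulKf// gt_eqF// exprn_gt0.
Qed.

Lemma martingale_series_cvg : {ae P, forall x, cvgn (series (X ^~ x))}.
Proof.
have invS_gt0 (j : nat) : 0 < (j.+1%:R^-1 : R) by rewrite invr_gt0.
apply: negligibleS (negligible_bigcup (fun j => negligible_oscillation (invS_gt0 j))).
move=> x /=; apply: contra_notP => settles; apply: cauchy_cvg; apply: cauchy_exP => e e0.
have [j _ /(_ j (leqnn j)) je] := near_infty_natSinv_lt (PosNum e0).
have [n small] : exists n, forall k, `|series (fun t => X (t + n)%N x) k| <= j.+1%:R^-1.
  apply: contrapT => /forallNP osc; apply: settles; exists j => // n.
  by apply: contrapT => /forallNP le_j; apply: (osc n) => k; rewrite leNgt; exact/negP.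
exists (series (X ^~ x) n), n => // k /= nk; rewrite /ball/= distrC (le_lt_trans _ je)//.
by have := small (k - n)%N; rewrite (series_shift (X ^~ x)) subnK.
Qed.

End MartingaleSeries.

Lemma ae_series_cvg (d : measure_display) (T : measurableType d) (R : realType)
    (P : {measure set T -> \bar R}) (f : nat -> T -> R) (v : nat -> R) :
  (forall t, measurable_fun setT (f t)) -> (forall t x, 0 <= f t x) ->
  (forall t, (\int[P]_x (f t x)%:E <= (v t)%:E)%E) -> cvgn (series v) ->
  {ae P, forall x, cvgn (series (f ^~ x))}.
Proof.
move=> mf f0 fv cv; pose S x := (\sum_(t <oo) (f t x)%:E)%E.
have S0 x : (0 <= S x)%E by apply: nneseries_ge0 => t _ _; rewrite lee_fin.
have iS : P.-integrable setT S.
  apply/integrableP; split.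
    by apply: ge0_emeasurable_sum => *; [rewrite lee_fin|exact/measurable_EFinP].
  under eq_integral do rewrite gee0_abs//.
  rewrite /S integral_nneseries//; [|by move=> t; exact/measurable_EFinP|
    by move=> t x _; rewrite lee_fin].
  apply: (@le_lt_trans _ _ (\sum_(t <oo) (v t)%:E)%E); last by rewrite nneseriesE// ltry.
  by apply: lee_nneseries => t *; [apply: integral_ge0 => x _; rewrite lee_fin|exact: fv].
apply: filterS (integrable_ae measurableT iS) => x /(_ I) finS.
by apply: nnseries_is_cvg => //; rewrite -ge0_fin_numE// S0.
Qed.

Lemma integral_sqr_weight_le (d : measure_display) (T : measurableType d) (R : realType)
    (mu : {measure set T -> \bar R}) (A : set T) (X Y : T -> R) (C : R) :
  measurable A -> measurable_fun setT Y -> measurable_fun setT X ->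
  (forall x, `|Y x| <= C * \1_A x) ->
  (\int[mu]_x ((Y x * X x) ^+ 2)%:E <= (C ^+ 2)%:E * \int[mu]_(x in A) (X x ^+ 2)%:E)%E.
Proof.
move=> mA mY mX YC; have mXA : measurable_fun setT (fun x => X x ^+ 2 * \1_A x).
  by apply: measurable_funM => //; exact: measurable_funX.
have XA0 x : 0 <= X x ^+ 2 * \1_A x by rewrite mulr_ge0 ?sqr_ge0.
rewrite [X in (_ * X)%E]integral_mkcond epatch_indic.
rewrite -ge0_integralZl ?lee_fin ?sqr_ge0//;
  [|exact/measurable_EFinP|by move=> x _; rewrite -EFinM lee_fin].
apply: ge0_le_integral => //.
- by move=> x _; rewrite lee_fin sqr_ge0.
- by apply/measurable_EFinP; apply: measurable_funX; exact: measurable_funM.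
- by apply/measurable_EFinP; exact: measurable_funM.
- move=> x _; rewrite -!EFinM lee_fin exprMn [leRHS]mulrCA [leLHS]mulrC ler_wpM2l ?sqr_ge0//.
  have := YC x; rewrite indicE; case: (_ \in _); rewrite ?mulr1 ?mulr0 => YCx.
    by rewrite -(real_normK (num_real (Y x))) lerXn2r// nnegrE// (le_trans _ YCx).
  by move: YCx; rewrite normr_le0 => /eqP ->; rewrite expr0n.
Qed.

Section LocalizedSeries.
Context (d : measure_display) (T : measurableType d) (R : realType) (P : probability T R).
Context (A : nat -> nat -> set T) (A_ae : {ae P, forall x, exists K, forall t, A K t x}).

Lemma localized_ae_series_cvg (f : nat -> T -> R) (B : nat -> R) (v : nat -> R) :
  (forall K t, measurable (A K t)) ->
  (forall t, measurable_fun setT (f t)) -> (forall t x, 0 <= f t x) ->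
  (forall K t, (\int[P]_(x in A K t) (f t x)%:E <= (B K)%:E)%E) ->
  (forall t, 0 <= v t) -> cvgn (series v) ->
  {ae P, forall x, cvgn (series (fun t => v t * f t x))}.
Proof.
move=> mA mf f0 fB v0 cv.
have localized : {ae P, forall x K, cvgn (series (fun t => \1_(A K t) x * (v t * f t x)))}.
  apply/ae_foralln => K; apply: (ae_series_cvg (v := fun t => B K * v t)) => [t|t x|t|].
  - by apply: measurable_funM => //; exact: measurable_funM.
  - by rewrite mulr_ge0// mulr_ge0.
  - have fBt := fB K t; rewrite integral_mkcond epatch_indic in fBt.
    under eq_integral do rewrite mulrC -mulrA EFinM.
    rewrite ge0_integralZl ?lee_fin//.
    + by rewrite [B K * _]mulrC EFinM lee_wpmul2l ?lee_fin.
    + by apply/measurable_EFinP; exact: measurable_funM.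
    + by move=> x _; rewrite lee_fin mulr_ge0.
  - exact: cvg_seriesM.
apply: filterS2 A_ae localized => x [K AK] /(_ K).
by under eq_fun do rewrite indicE mem_set ?mul1r//.
Qed.

Context (F : nat -> set (set T)) (sF : forall k, F k `<=` measurable).
Context (ndF : forall k, <<s F k >> `<=` <<s F k.+1 >>) (FA : forall K t, <<s F t >> (A K t)).
Context (xi : nat -> T -> R) (mxi : forall t, measurable_wrt (F t.+1) (xi t)).
Context (ixi : forall t, P.-integrable setT (EFin \o xi t)).
Context (xi0 : forall t, centered_given P (F t) (xi t)).
Context (B : nat -> R).
Context (xi2 : forall K t, (\int[P]_(x in A K t) (xi t x ^+ 2)%:E <= (B K)%:E)%E).

Lemma weighted_martingale_series_cvg (Y : nat -> T -> R) (C : R) (g : nat -> R) :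
  (forall t, measurable_wrt (F t) (Y t)) -> (forall t x, `|Y t x| <= C) ->
  cvgn (series (fun t => g t ^+ 2)) ->
  {ae P, forall x, cvgn (series (fun t => g t * xi t x * Y t x))}.
Proof.
move=> mY YC cg.
pose weight K t x : R := g t * (\1_(A K t) x * Y t x).
have mA K t : measurable (A K t) := sub_g_sigma (@sF t) (@FA K t).
have mxiT t : measurable_fun setT (xi t) by exact: measurable_wrt_fun (@sF _) (@mxi t).
have mweight K t : measurable_wrt (F t) (weight K t).
  apply: measurable_funM => //; apply: measurable_funM; last exact: mY.
  exact: measurable_wrt_indic (@FA K t).
have weightC K t x : `|weight K t x| <= `|g t| * C * \1_(A K t) x.
  rewrite indicE /weight indicE; case: (_ \in _) => /=; last by rewrite mul0r !mulr0 normr0.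
  by rewrite mul1r mulr1 normrM ler_wpM2l.
have localized : {ae P, forall x K, cvgn (series (fun t => weight K t x * xi t x))}.
  apply/ae_foralln => K.
  apply: (martingale_series_cvg sF ndF _ _ (v := fun t => C ^+ 2 * B K * g t ^+ 2)).
  - by move=> t; apply: measurable_funM (@mxi t); exact: measurable_wrtS (@ndF t) (@mweight K t).
  - move=> t; apply: (@centered_bounded_weight _ _ _ _ _ _ _ _ (`|g t| * C)) => // x.
    apply: le_trans (weightC K t x) _; rewrite ler_piMr ?indicE ?lern1 ?leq_b1//.
    by rewrite mulr_ge0// (le_trans _ (YC t x)).
  - move=> t; apply: le_trans (integral_sqr_weight_le P (mA K t) _ (mxiT t) (weightC K t)) _.
      exact: measurable_wrt_fun (@mweight K t).
    have -> : C ^+ 2 * B K * g t ^+ 2 = (`|g t| * C) ^+ 2 * B K.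
      by rewrite exprMn real_normK ?num_real//; ring.
    by rewrite [leRHS]EFinM lee_wpmul2l// lee_fin sqr_ge0.
  - exact: cvg_seriesM.
apply: filterS2 A_ae localized => x [K AK] /(_ K).
by under eq_fun do rewrite /weight indicE mem_set ?mul1r// mulrAC.
Qed.

End LocalizedSeries.

Lemma sqr_le_powR (R : realType) (rho y : R) : 2 <= rho -> 0 <= y -> y ^+ 2 <= 1 + y `^ rho.
Proof.
move=> rho2 y0; have [y1|y1] := leP y 1.
  by rewrite (le_trans (exprn_ile1 2 y0 y1))// lerDl powR_ge0.
rewrite -powR_mulrn//; apply: le_trans (ler_powR (ltW y1) rho2) _.
by rewrite lerDr.
Qed.

Section ConditionalMoments.
Context (d : measure_display) (T : measurableType d) (R : realType) (P : probability T R).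
Context (G : set (set T)) (sG : G `<=` measurable) (M : T -> \bar R).
Context (M_meas : forall B : set (\bar R), measurable B -> <<s G >> (M @^-1` B)).

Definition moment_le (K : nat) : set T := M @^-1` [set y | (y <= K%:R%:E)%E].

Lemma moment_le_g_sigma K : <<s G >> (moment_le K).
Proof.
apply: M_meas; have := @emeasurable_itv R `]-oo, K%:R%:E].
by rewrite set_itvE.
Qed.

Let measurable_moment_le K : measurable (moment_le K).
Proof. exact: sub_g_sigma (@moment_le_g_sigma K). Qed.

Lemma integral_moment_le (q : T -> R) K :
  (forall A, <<s G >> A -> (\int[P]_(x in A) (q x)%:E = \int[P]_(x in A) M x)%E) ->
  (\int[P]_(x in moment_le K) (q x)%:E <= K%:R%:E)%E.
Proof.
move=> qM; rewrite qM; last exact: moment_le_g_sigma.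
have mM : measurable_fun setT M.
  by move=> _ B mB; rewrite setTI; apply: (sub_g_sigma sG); exact: M_meas.
rewrite integralE; apply: (@le_trans _ _ (\int[P]_(x in moment_le K) M^\+ x)%E).
  by apply: geeDl; rewrite oppe_le0; apply: integral_ge0.
apply: (@le_trans _ _ (\int[P]_(x in moment_le K) cst K%:R%:E x)%E).
  apply: ge0_le_integral => //; first by apply: measurable_funepos; exact: measurable_funS mM.
  by move=> x Kx; rewrite funeposE ge_max Kx/= lee_fin.
rewrite integral_cst// -[leRHS]mule1; apply: lee_wpmul2l; first by rewrite lee_fin.
exact: probability_le1.
Qed.

Lemma integral_sqr_moment_le (rho : R) (y : T -> R) K : 2 <= rho -> measurable_fun setT y ->
  (forall x, 0 <= y x) ->
  (forall A, <<s G >> A -> (\int[P]_(x in A) (y x `^ rho)%:E = \int[P]_(x in A) M x)%E) ->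
  (\int[P]_(x in moment_le K) (y x ^+ 2)%:E <= (1 + K%:R)%:E)%E.
Proof.
move=> rho2 my y0 yM; have mA := measurable_moment_le K.
have mpow : measurable_fun setT (fun x => (y x `^ rho)%:E).
  by apply/measurable_EFinP; exact: measurableT_comp (measurable_powR rho) my.
apply: (@le_trans _ _ (\int[P]_(x in moment_le K) (1%:E + (y x `^ rho)%:E))%E).
  apply: ge0_le_integral => //.
  - by move=> x _; rewrite lee_fin sqr_ge0.
  - by apply: measurable_funS measurableT _ _ => //; apply/measurable_EFinP; exact: measurable_funX.
  - by apply: measurable_funS measurableT _ _ => //; exact: emeasurable_funD.
  - by move=> x _; rewrite -EFinD lee_fin sqr_le_powR.
rewrite ge0_integralD//; [|by move=> x _; rewrite lee_fin powR_ge0|exact: measurable_funS mpow].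
rewrite EFinD leeD ?integral_moment_le// integral_cst// mul1e.
exact: probability_le1.
Qed.

End ConditionalMoments.

(** * Independent dither *)

Lemma indep_g_sigma (d : measure_display) (T : measurableType d) (R : realType)
    (P : probability T R) (E : set (set T)) (B : set T) :
  E `<=` measurable -> setI_closed E -> E setT -> measurable B ->
  (forall A, E A -> P (A `&` B) = (P A * P B)%E) ->
  forall A, <<s E >> A -> P (A `&` B) = (P A * P B)%E.
Proof.
move=> sE EI ET mB indep A GA; have pB0 : 0 <= fine (P B) by rewrite fine_ge0.
have PBE : (fine (P B))%:E = P B by rewrite fineK ?fin_num_measure.
suff restrE : mrestr P mB A = mscale (NngNum pB0) P A.
  by rewrite -[LHS]/(mrestr P mB A) restrE -[LHS]/((fine (P B))%:E * P A)%E PBE muleC.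
apply: (@g_sigma_algebra_measure_unique _ R _ E sE (fun=> setT)) => //.
- by apply: bigcup_const; exists 0%N.
- move=> C EC; rewrite -[LHS]/(P (C `&` B)) -[RHS]/((fine (P B))%:E * P C)%E.
  by rewrite indep// PBE muleC.
- move=> _; rewrite -[ltLHS]/(P (setT `&` B)) setTI.
  exact: le_lt_trans (probability_le1 _ mB) (ltry 1).
Qed.

Section Freezing.
Context (d : measure_display) (T : measurableType d) (R : realType).
Context (P : probability T R) (G : set (set T)) (sG : G `<=` measurable).
Context (D : T -> R) (mD : measurable_fun setT D).
Context (indep : forall A B, <<s G >> A -> measurable B ->
  P (A `&` D @^-1` B) = (P A * P (D @^-1` B))%E).

Let idG (x : T) : g_sigma_algebraType G := x.
Let m_idG : measurable_fun setT idG.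
Proof. by move=> _ B mB; rewrite setTI; exact: (sub_g_sigma sG). Qed.
Let pairG (x : T) : g_sigma_algebraType G * R := (idG x, D x).
Let m_pairG : measurable_fun setT pairG.
Proof. exact: measurable_fun_pair. Qed.

HB.instance Definition _ := isMeasurableFun.Build _ _ _ _ idG m_idG.
HB.instance Definition _ := isMeasurableFun.Build _ _ _ _ D mD.
HB.instance Definition _ := isMeasurableFun.Build _ _ _ _ pairG m_pairG.

Lemma freezing_integral (f : g_sigma_algebraType G * R -> R) (C : R) :
  measurable_fun setT f -> (forall q, `|f q| <= C) ->
  (\int[P]_x (f (x, D x))%:E = \int[P]_x \int[P]_y (f (x, D y))%:E)%E.
Proof.
move=> mf fC; have mEf : measurable_fun setT (EFin \o f) by exact/measurable_EFinP.
have section_integral x : (\int[distribution P D]_u (f (x, u))%:E = \int[P]_y (f (x, D y))%:E)%E.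
  have mfx : measurable_fun setT (fun u => f (x, u)) by apply: measurableT_comp.
  rewrite integral_distribution//; first exact/measurable_EFinP.
  apply: (bounded_integrable _ (C := C)) => //.
  exact: measurableT_comp mfx mD.
have if_prod : (distribution P idG \x distribution P D)%E.-integrable setT (EFin \o f).
  exact: (bounded_integrable _ mf fC).
transitivity (\int[distribution P pairG]_q (f q)%:E)%E.
  rewrite integral_distribution//; apply: (bounded_integrable _ (C := C)) => //.
  exact: measurableT_comp.
transitivity (\int[distribution P idG \x distribution P D]_q (f q)%:E)%E.
  apply: eq_measure_integral => A mA _; symmetry.
  by apply: product_measure_unique => // B1 B2 mB1 mB2; exact: indep.
have mF := measurable_fubini_F if_prod; have /integrableP[_ iF] := integrable_fubini_F if_prod.
rewrite -integral12_prod_meas1// integral_distribution//.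
  by apply: eq_integral => x _; exact: section_integral.
apply/integrableP; split; first exact: (measurableT_comp mF m_idG).
rewrite -(ge0_integral_distribution idG (f := abse \o fubini_F _ (EFin \o f)))//; last first.
  by move=> x; exact: abse_ge0.
by apply: measurableT_comp => //; exact: mF.
Qed.

Lemma freezing_centered (f : g_sigma_algebraType G * R -> R) (C : R) :
  measurable_fun setT f -> (forall q, `|f q| <= C) ->
  (forall x, \int[P]_y (f (x, D y))%:E = 0)%E -> centered_given P G (fun x => f (x, D x)).
Proof.
move=> mf fC f0 A GA; pose g q : R := \1_(A : set (g_sigma_algebraType G)) q.1 * f q.
have mg : measurable_fun setT g.
  apply: measurable_funM => //; apply: measurableT_comp; last exact: measurable_fst.
  exact: measurable_wrt_indic.
have gC q : `|g q| <= C.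
  rewrite normrM; apply: le_trans (fC q); rewrite ler_piMl//.
  by rewrite indicE; case: (_ \in _); rewrite ?normr1 ?normr0.
rewrite integral_mkcond epatch_indic.
transitivity (\int[P]_x (g (x, D x))%:E)%E.
  by apply: eq_integral => x _; rewrite /g/= EFinM muleC.
rewrite (freezing_integral mg gC) integral0_eq// => x _; rewrite /g/= indicE.
by case: (_ \in _); [under eq_integral do rewrite mul1r|under eq_integral do rewrite mul0r];
  rewrite ?f0 ?integral0.
Qed.

End Freezing.

Section LaplaceDither.
Context (d : measure_display) (T : measurableType d) (R : realType) (P : probability T R).
Context (D : T -> R) (mD : measurable_fun setT D).
Context (D_lap : forall u, P [set x | D x <= u] = (lap_cdf u)%:E).

Let measurable_preimage_D (B : set R) : measurable B -> measurable (D @^-1` B).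
Proof. by move=> mB; rewrite -[X in measurable X]setTI; exact: mD. Qed.

Lemma prob_laplace_gt u : P [set x | u < D x] = (lap_cdf (- u))%:E.
Proof.
have -> : [set x | u < D x] = ~` [set x | D x <= u].
  by apply/seteqP; split => x /=; rewrite ltNge => /negP.
rewrite probability_setC ?D_lap ?lap_cdfN ?EFinB//.
by have := measurable_preimage_D (measurable_itv `]-oo, u]); rewrite set_itvE.
Qed.

Lemma prob_laplace_lt u : P [set x | D x < u] = (lap_cdf u)%:E.
Proof.
have mlt : measurable [set x | D x < u].
  by have := measurable_preimage_D (measurable_itv `]-oo, u[); rewrite set_itvE.
have mle v : measurable [set x | D x <= v].
  by have := measurable_preimage_D (measurable_itv `]-oo, v]); rewrite set_itvE.
apply/eqP; rewrite eq_le; apply/andP; split.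
  by rewrite -D_lap; apply: le_measure; rewrite ?inE// => x /ltW.
apply/lee_addgt0Pr => e e0.
have := @lap_cdf_lip _ (u - e) u; rewrite gerBl ltW// => /(_ isT) /andP[_ lip].
apply: (@le_trans _ _ (lap_cdf (u - e) + e)%:E); first by rewrite lee_fin; lra.
by rewrite EFinD leeD2r// -D_lap; apply: le_measure; rewrite ?inE// => x /=; lra.
Qed.

Lemma integral_quantized_laplace (b c y : R) : 0 < b -> 0 <= c ->
  (\int[P]_x (quantized c (y + b * D x))%:E = (mean_quantized c b y)%:E)%E.
Proof.
move=> b0 c0; pose U := [set x | (c - y) / b < D x]; pose L := [set x | D x < (- y - c) / b].
have mU : measurable U.
  by have := measurable_preimage_D (measurable_itv `](c - y) / b, +oo[); rewrite set_itvE.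
have mL : measurable L.
  by have := measurable_preimage_D (measurable_itv `]-oo, (- y - c) / b[); rewrite set_itvE.
transitivity (\int[P]_x ((\1_U x)%:E - (\1_L x)%:E))%E.
  apply: eq_integral => x _; rewrite quantizedE// -EFinB !indicE; congr (_%:R - _%:R)%:E.
    congr nat_of_bool; apply/idP/idP; rewrite inE /U/= ltr_pdivrMr//; lra.
  congr nat_of_bool; apply/idP/idP; rewrite inE /L/= ltr_pdivlMr//; lra.
rewrite integralB_EFin//; [|exact: integrable_indic|exact: integrable_indic].
rewrite !integral_indic// !setIT -[LHS]/(P U - P L)%E prob_laplace_gt prob_laplace_lt -EFinB.
by congr (lap_cdf _ - _)%:E; rewrite -mulNr opprB.
Qed.

Lemma dither_centered (G : set (set T)) (x : T -> R) (b c : R) : G `<=` measurable ->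
  (forall A B, <<s G >> A -> measurable B -> P (A `&` D @^-1` B) = (P A * P (D @^-1` B))%E) ->
  measurable_wrt G x -> 0 < b -> 0 <= c ->
  centered_given P G (fun om => quantized c (x om + b * D om) - mean_quantized c b (x om)).
Proof.
move=> sG indep mx b0 c0.
pose f (q : g_sigma_algebraType G * R) :=
  quantized c (x q.1 + b * q.2) - mean_quantized c b (x q.1).
have mx1 : measurable_fun setT (fun q : g_sigma_algebraType G * R => x q.1).
  exact: measurableT_comp mx measurable_fst.
have mf : measurable_fun setT f.
  apply: measurable_funB; last exact: measurableT_comp (measurable_mean_quantized c b) mx1.
  apply: measurableT_comp (measurable_quantized c) _; apply: measurable_funD => //.
  exact: measurable_funM.
apply: (freezing_centered sG mD indep mf (C := 2)) => [q|om].
  rewrite (le_trans (ler_normB _ _))// (_ : 2 = 1 + 1 :> R)// lerD//.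
    exact: norm_quantized_le1.
  exact: norm_mean_quantized_le1.
have mfx : measurable_fun setT (fun y => quantized c (x om + b * D y)).
  apply: measurableT_comp (measurable_quantized c) _; apply: measurable_funD => //.
  exact: measurable_funM.
transitivity (\int[P]_y ((quantized c (x om + b * D y))%:E -
    (cst (mean_quantized c b (x om)) y)%:E))%E => //.
rewrite integralB_EFin//.
- rewrite -[LHS]/(\int[P]_y (quantized c (x om + b * D y))%:E -
    \int[P]_y cst (mean_quantized c b (x om))%:E y)%E.
  rewrite integral_quantized_laplace// integral_cst//.
  by rewrite [X in (_ * X)%E](@probability_setT _ _ _ P) mule1 subee.
- by apply: (bounded_integrable _ (C := 1)) => // y; exact: norm_quantized_le1.
- exact: finite_measure_integrable_cst.
Qed.

End LaplaceDither.

Section NoiseFiltration.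
Context (dsp : measure_display) (Omega : measurableType dsp) (R : realType).
Context (P : probability Omega R) (N : nat) (m : 'I_N -> nat).
Context (w : forall i : 'I_N, nat -> Omega -> 'cV[R]_(m i)) (d : 'I_N -> nat -> Omega -> R).

Definition noise_filtration (k : nat) : set (set Omega) := gen_w w k `|` gen_d d k.

Lemma noise_filtration_nd k : <<s noise_filtration k >> `<=` <<s noise_filtration k.+1 >>.
Proof.
apply: sub_smallest2r => // A [] [i [t gen]]; [left|right]; exists i, t.
  case: gen => l [B [/andP[t1 tk] gen]]; exists l, B; split => //.
  by rewrite t1 (leq_trans tk).
case: gen => B [/andP[t1 tk] gen]; exists B; split => //.
by rewrite t1 (leq_trans tk).
Qed.

Lemma sub_gen_w_noise k : <<s gen_w w k >> `<=` <<s noise_filtration k >>.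
Proof. by apply: sub_smallest2r => // A; left. Qed.

Lemma measurable_wrt_w i k (l : 'I_(m i)) : (0 < k)%N ->
  measurable_wrt (noise_filtration k) (fun om => w i k om l 0).
Proof.
move=> k0 _ B mB; rewrite setTI; apply: sub_sigma_algebra; left.
by exists i, k, l, B; rewrite k0 leqnn.
Qed.

Lemma measurable_wrt_d i k : (0 < k)%N -> measurable_wrt (noise_filtration k) (d i k).
Proof.
move=> k0 _ B mB; rewrite setTI; apply: sub_sigma_algebra; right.
by exists i, k, B; rewrite k0 leqnn.
Qed.

Context (w_meas : forall i k (l : 'I_(m i)), (1 <= k)%N ->
  measurable_fun setT (fun om => w i k om l 0)).
Context (d_meas : forall i k, (1 <= k)%N -> measurable_fun setT (d i k)).

Lemma gen_w_measurable k : gen_w w k `<=` measurable.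
Proof.
move=> _ [i [t [l [B [/andP[t1 _] [mB ->]]]]]].
by rewrite -[X in measurable X]setTI; exact: w_meas.
Qed.

Let measurable_preimage_d i k B : (0 < k)%N -> measurable B -> measurable (d i k @^-1` B).
Proof. by move=> k0 mB; rewrite -[X in measurable X]setTI; exact: d_meas. Qed.

Lemma noise_filtration_measurable k : noise_filtration k `<=` measurable.
Proof.
move=> A [/gen_w_measurable//|[i [t [B [/andP[t1 _] [mB ->]]]]]].
exact: measurable_preimage_d.
Qed.

Context (d_indep : forall (s : seq ('I_N * nat)) (B : 'I_N -> nat -> set R) (A : set Omega),
  uniq s -> all (fun q => (1 <= q.2)%N) s ->
  (forall i k, measurable (B i k)) -> <<s gen_w_all w >> A ->
  P (A `&` \big[setI/setT]_(q <- s) (d q.1 q.2 @^-1` B q.1 q.2))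
  = (P A * \prod_(q <- s) P (d q.1 q.2 @^-1` B q.1 q.2))%E).

Let past k : seq ('I_N * nat) := [seq (i, t) | i <- enum 'I_N, t <- iota 1 k].

Let mem_past k i t : ((i, t) \in past k) = (0 < t <= k)%N.
Proof.
apply/allpairsP/idP => [[[i' t'] /= [_ + [_ ->]]]|tk]; first by rewrite mem_iota add1n ltnS.
by exists (i, t); rewrite mem_enum mem_iota add1n ltnS.
Qed.

Let past_uniq k : uniq (past k).
Proof. by rewrite allpairs_uniq ?enum_uniq ?iota_uniq// => -[? ?] [? ?]. Qed.

Let past_gt0 k : all (fun q => (0 < q.2)%N) (past k).
Proof. by apply/allP => -[i t]; rewrite mem_past => /andP[]. Qed.

Let dither_event k (B : 'I_N -> nat -> set R) : set Omega :=
  \big[setI/setT]_(q <- past k) (d q.1 q.2 @^-1` B q.1 q.2).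

Let cylinder k : set (set Omega) := [set A | exists Aw B, [/\ <<s gen_w_all w >> Aw,
  forall i t, measurable (B i t) & A = Aw `&` dither_event k B]].

Let gen_w_allT : <<s gen_w_all w >> setT.
Proof. exact: (@measurableT _ (g_sigma_algebraType (gen_w_all w))). Qed.

Let cylinder_measurable k : cylinder k `<=` measurable.
Proof.
move=> _ [Aw [B [GAw mB ->]]]; apply: measurableI.
  by apply: sub_g_sigma GAw => C [t _]; exact: gen_w_measurable.
rewrite /dither_event big_seq; apply: (big_ind measurable) => //; first exact: measurableI.
by move=> [i t]; rewrite mem_past => /andP[t0 _]; exact: measurable_preimage_d.
Qed.

Let cylinder_setI k : setI_closed (cylinder k).
Proof.
move=> _ _ [A1 [B1 [GA1 mB1 ->]]] [A2 [B2 [GA2 mB2 ->]]].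
exists (A1 `&` A2), (fun i t => B1 i t `&` B2 i t); split.
- exact: (@measurableI _ (g_sigma_algebraType (gen_w_all w))).
- by move=> i t; exact: measurableI.
- rewrite setIACA; congr (_ `&` _); rewrite /dither_event -big_split/=.
  by apply: eq_bigr => q _; rewrite preimage_setI.
Qed.

Let noise_sub_cylinder k : noise_filtration k `<=` cylinder k.
Proof.
move=> C [genC|[i [t [B [tk [mB ->]]]]]].
  exists C, (fun _ _ => setT); split => //; last by rewrite /dither_event big1 ?setIT.
  by apply: sub_sigma_algebra; exists k.
exists setT, (fun i' t' => if (i', t') == (i, t) then B else setT); split => //.
  by move=> i' t'; case: ifP.
rewrite setTI /dither_event (bigD1_seq (i, t)) ?mem_past//= eqxx big1 ?setIT//.
by move=> [i' t'] /= /negbTE ->; exact: preimage_setT.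
Qed.

Let cylinder_indep k i A B : cylinder k A -> measurable B ->
  P (A `&` d i k.+1 @^-1` B) = (P A * P (d i k.+1 @^-1` B))%E.
Proof.
move=> [Aw [C [GAw mC ->]]] mB.
pose C' j t := if (j, t) == (i, k.+1) then B else C j t.
have mC' j t : measurable (C' j t) by rewrite /C'; case: ifP.
have C'_past q : q \in past k -> C' q.1 q.2 = C q.1 q.2.
  case: q => j t; rewrite mem_past /C' /= => /andP[_ tk]; case: eqP => // -[_ tk'].
  by rewrite tk' ltnn in tk.
have uniq_now : uniq ((i, k.+1) :: past k) by rewrite /= past_uniq mem_past ltnn andbF.
have := d_indep uniq_now _ mC' GAw; rewrite /= past_gt0 => /(_ isT).
rewrite !big_cons /= [C' i k.+1]/C' eqxx.
under eq_big_seq do rewrite C'_past//.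
under [X in (_ * (_ * X))%E]eq_big_seq do rewrite C'_past//.
by rewrite -setIA [dither_event k C `&` _]setIC => ->; rewrite d_indep// muleCA muleC.
Qed.

Lemma dither_indep k i A B : <<s noise_filtration k >> A -> measurable B ->
  P (A `&` d i k.+1 @^-1` B) = (P A * P (d i k.+1 @^-1` B))%E.
Proof.
move=> GA mB; apply: (indep_g_sigma (@cylinder_measurable k) (@cylinder_setI k)).
- exists setT, (fun _ _ => setT); split => //.
  by rewrite setTI /dither_event big1// => q _; exact: preimage_setT.
- exact: measurable_preimage_d.
- by move=> C cylC; exact: cylinder_indep.
- exact: (sub_smallest2r (smallest_sigma_algebra _ _) (@noise_sub_cylinder k) GA).
Qed.

End NoiseFiltration.

(** * Perturbed Lyapunov recursions *)

Section LyapunovRecursion.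
Context (R : realType).
Implicit Types V D M E u z eta : nat -> R.

Lemma quasi_fejer_cvg V D u : (forall k, 0 <= V k) -> (forall k, 0 <= D k) ->
  (forall k, V k.+1 <= V k - D k + u k) -> cvgn (series u) -> cvgn V /\ cvgn (series D).
Proof.
move=> V0 D0 VS cu; pose W k := V k - series u k.
have WS k : D k <= W k - W k.+1 by rewrite /W seriesSr; have := VS k; lra.
have [B uB] : exists B, forall k, series u k <= B.
  have /bounded_fun_has_ubound[B uB] := cvg_seq_bounded cu.
  by exists B => k; apply: uB; exists k.
have cW : cvgn W.
  apply: nonincreasing_is_cvgn.
    by apply/nonincreasing_seqP => k; have := WS k; have := D0 k; lra.
  by exists (- B) => _ [k _ <-]; rewrite /W; have := uB k; have := V0 k; lra.
split.
  rewrite (_ : V = W \+ series u); first exact: is_cvgD.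
  by apply/funext => k; rewrite /W/= subrK.
apply: (bounded_series_cvg (B := W 0%N + B)) => // k.
apply: (@le_trans _ _ (W 0%N - W k)); last by rewrite lerD2l /W; have := uB k; have := V0 k; lra.
elim: k => [|k IH]; first by rewrite subrr /series/= big_geq.
by rewrite seriesSr; have := WS k; lra.
Qed.

(* Passing to [ln (1 + V)] makes the multiplicative perturbation additive. *)
Lemma lyapunov_recursion_cvg V D M (r : nat -> R) : (forall k, 0 <= V k) -> (forall k, 0 <= D k) ->
  (forall k, V k.+1 <= V k - D k + M k + r k * (1 + V k)) ->
  cvgn (series (fun k => M k / (1 + V k))) -> cvgn (series r) ->
  cvgn V /\ cvgn (series D).
Proof.
move=> V0 D0 VS cM cr; have V1 k : 0 < 1 + V k by apply: ltr_pwDl.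
have [] := @quasi_fejer_cvg (fun k => ln (1 + V k)) (fun k => D k / (1 + V k))
  ((fun k => M k / (1 + V k)) + r).
- by move=> k; apply: ln_ge0; rewrite lerDl.
- by move=> k; rewrite divr_ge0// ltW.
- move=> k; rewrite -lerBlDl -lerBlDl; have : ln (1 + V k.+1) - ln (1 + V k) <=
      (1 + V k.+1) / (1 + V k) - 1.
    rewrite -ln_div ?posrE// -[X in ln X](subrKC 1); apply: le_ln1Dx.
    by rewrite ltrBrDl subrr divr_gt0.
  have : (1 + V k.+1) / (1 + V k) - 1 <= - (D k / (1 + V k)) + M k / (1 + V k) + r k.
    rewrite lerBlDr ler_pdivrMr// !mulrDl mulNr !divfK ?gt_eqF// mul1r.
    by have := VS k; lra.
  by rewrite /=; lra.
- exact: is_cvg_seriesD.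
move=> cL cDV; have cV : cvgn V.
  have -> : V = (fun k => expR (ln (1 + V k)) - 1).
    by apply/funext => k; rewrite lnK ?posrE// addrC addKr.
  apply: is_cvgB; last exact: is_cvg_cst.
  apply/cvg_ex; exists (expR (limn (fun k => ln (1 + V k)))).
  by apply: continuous_cvg => //; exact: continuous_expR.
have /bounded_fun_has_ubound[B VB] := cvg_seq_bounded cV.
split=> //; apply: (series_le_cvg D0 _ _ (cvg_seriesM (c := 1 + B) cDV)) => k.
  rewrite mulr_ge0 ?divr_ge0 ?(ltW (V1 k))//.
  by rewrite (le_trans (ltW (V1 0%N)))// lerD2l; apply: VB; exists 0%N.
rewrite mulrCA ler_peMr// ler_pdivlMr// mul1r lerD2l.
by apply: VB; exists k.
Qed.

Lemma excitation_limit_le0 V E eta z (c C l : R) (q : nat) :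
  (forall k, 0 <= E k) -> (forall k, 0 <= z k) -> 0 <= c -> 1 <= C ->
  (forall k, z k.+1 <= C * z k) ->
  (forall k, V k <= c * \sum_(r < q) E (k + r)%N + eta k) ->
  eta k @[k --> \oo] --> (0 : R) -> V k @[k --> \oo] --> l ->
  cvgn (series (fun k => z k * E k)) -> ~ cvgn (series z) -> l <= 0.
Proof.
move=> E0 z0 c0 C1 zC VE eta0 cV czE; apply: contra_notT; rewrite -ltNge => l0.
have [K _ excited] : \forall k \near \oo, l / 2 <= c * \sum_(r < q) E (k + r)%N.
  have : V k - eta k @[k --> \oo] --> l by rewrite -[l]subr0; exact: cvgB.
  move=> /(cvgr_gt l) /(_ (l / 2) ltac:(lra)); apply: filterS => k.
  by have := VE k; lra.
have zCr k r : z (k + r)%N <= C ^+ r * z k.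
  elim: r => [|r IH]; first by rewrite addn0 expr0 mul1r.
  rewrite addnS exprS -mulrA; apply: le_trans (zC _) _.
  by rewrite ler_wpM2l ?(le_trans ler01).
have z_le k : (K <= k)%N ->
    z (k + q)%N <= 2 / l * (c * C ^+ q) * \sum_(r < q) z (k + r)%N * E (k + r)%N.
  move=> Kk; rewrite [_ / _]mulrC -!mulrA ler_pdivlMl//.
  have := ler_wpM2l (z0 (k + q)%N) (excited k Kk).
  suff : z (k + q)%N * (c * \sum_(r < q) E (k + r)%N) <=
      c * (C ^+ q * \sum_(r < q) z (k + r)%N * E (k + r)%N) by nra.
  rewrite mulrCA ler_wpM2l// !mulr_sumr; apply: ler_sum => r _.
  rewrite mulrA ler_wpM2r//.
  have -> : (k + q = k + r + (q - r))%N by rewrite -addnA subnKC// ltnW.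
  apply: le_trans (zCr _ _) _; rewrite ler_wpM2r//.
  by rewrite ler_weXn2l// leq_subr.
apply/(cvg_series_shift _ (K + q)%N).
apply: (series_le_cvg (v_ := fun k => 2 / l * (c * C ^+ q) *
    \sum_(r < q) z (k + (K + r))%N * E (k + (K + r))%N)) => [k|k|k|] //.
- apply: mulr_ge0; last by apply: sumr_ge0 => r _; rewrite mulr_ge0.
  by rewrite mulr_ge0 ?divr_ge0 ?(ltW l0)// mulr_ge0// exprn_ge0// (le_trans ler01).
- rewrite addnA; apply: le_trans (z_le _ (leq_addl _ _)) _.
  by under eq_bigr do rewrite -addnA.
- apply: cvg_seriesM; apply: cvg_series_sum => r.
  exact/(cvg_series_shift (fun k => z k * E k)).
Qed.

End LyapunovRecursion.

(** * Column vectors *)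

Section FiniteSums.
Context (R : realType).

Lemma ler_term_sum (I : finType) (F : I -> R) i : (forall j, 0 <= F j) -> F i <= \sum_j F j.
Proof. by move=> F0; rewrite (bigD1 i)//= lerDl; apply: sumr_ge0. Qed.

Lemma sum2_ge0 (I J : finType) (F : I -> J -> R) : (forall i j, 0 <= F i j) ->
  0 <= \sum_i \sum_j F i j.
Proof. by move=> F0; apply: sumr_ge0 => i _; apply: sumr_ge0. Qed.

Lemma sqr_sum_le N (y : 'I_N -> R) : (\sum_i y i) ^+ 2 <= N%:R * \sum_i y i ^+ 2.
Proof.
rewrite expr2 mulr_suml.
apply: (@le_trans _ _ (\sum_i \sum_j 2^-1 * (y i ^+ 2 + y j ^+ 2))).
  apply: ler_sum => i _; rewrite mulr_sumr; apply: ler_sum => j _.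
  by have := sqr_ge0 (y i - y j); rewrite !expr2; lra.
under eq_bigr do rewrite -mulr_sumr big_split/= sumr_const card_ord.
rewrite -mulr_sumr big_split/= sumr_const card_ord sumrMnl mulr_natl.
by set s := _ *+ N; lra.
Qed.

Lemma finite_uniform_bound (I : finType) (Q : I -> R -> Prop) (c0 : R) :
  (forall i c c', c <= c' -> Q i c -> Q i c') -> (forall i, exists c, Q i c) ->
  exists2 c, c0 <= c & forall i, Q i c.
Proof.
move=> Qmono /choice[c Qc]; exists (\big[Order.max/c0]_i c i).
  exact: bigmax_ge_id.
by move=> i; apply: Qmono (Qc i); exact: le_bigmax.
Qed.

End FiniteSums.

Section ColumnVectors.
Context (R : realType).
Implicit Types n m k q : nat.

Definition dotv n (u v : 'cV[R]_n) : R := \sum_r u r 0 * v r 0.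
Definition sqnorm n (u : 'cV[R]_n) : R := \sum_r u r 0 ^+ 2.

Lemma sqnorm_ge0 n (u : 'cV[R]_n) : 0 <= sqnorm u.
Proof. by apply: sumr_ge0 => r _; exact: sqr_ge0. Qed.

Lemma sqr_vnorm n (u : 'cV[R]_n) : vnorm u ^+ 2 = sqnorm u.
Proof. by rewrite sqr_sqrtr// sqnorm_ge0. Qed.

Lemma sqr_coord_le n (u : 'cV[R]_n) r : u r 0 ^+ 2 <= sqnorm u.
Proof. by apply: (ler_term_sum (F := fun r => u r 0 ^+ 2)) => s; exact: sqr_ge0. Qed.

Lemma sqnorm_mulmx_le n m (M : 'M[R]_(m, n)) c x : 0 <= c -> opnorm_le M c ->
  sqnorm (M *m x) <= c ^+ 2 * sqnorm x.
Proof.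
move=> c0 /(_ x) Mx; rewrite -!sqr_vnorm -exprMn lerXn2r// nnegrE ?sqrtr_ge0//.
by rewrite mulr_ge0// sqrtr_ge0.
Qed.

Lemma mulmx_dotv n (u v : 'cV[R]_n) : (u^T *m v) 0 0 = dotv u v.
Proof. by rewrite mxE; apply: eq_bigr => r _; rewrite mxE. Qed.

Lemma dotvC n (u v : 'cV[R]_n) : dotv u v = dotv v u.
Proof. by apply: eq_bigr => r _; rewrite mulrC. Qed.

Lemma dotvv n (u : 'cV[R]_n) : dotv u u = sqnorm u. Proof. by []. Qed.

Lemma dotvDr n (u v w : 'cV[R]_n) : dotv u (v + w) = dotv u v + dotv u w.
Proof. by rewrite -big_split/=; apply: eq_bigr => r _; rewrite mxE mulrDr. Qed.

Lemma dotvBr n (u v w : 'cV[R]_n) : dotv u (v - w) = dotv u v - dotv u w.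
Proof. by rewrite -sumrB; apply: eq_bigr => r _; rewrite !mxE mulrBr. Qed.

Lemma dotvZr n (u v : 'cV[R]_n) c : dotv u (c *: v) = c * dotv u v.
Proof. by rewrite mulr_sumr; apply: eq_bigr => r _; rewrite mxE mulrCA. Qed.

Lemma dotv_trmx n m (M : 'M[R]_(m, n)) u v : dotv u (M^T *m v) = dotv (M *m u) v.
Proof. by rewrite -!mulmx_dotv trmx_mul mulmxA. Qed.

Lemma sqnormD n (u v : 'cV[R]_n) : sqnorm (u + v) = sqnorm u + 2 * dotv u v + sqnorm v.
Proof.
by rewrite mulr_sumr -!big_split/=; apply: eq_bigr => r _; rewrite mxE; ring.
Qed.

Lemma sqnormB n (u v : 'cV[R]_n) : sqnorm (u - v) = sqnorm u - 2 * dotv u v + sqnorm v.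
Proof.
by rewrite mulr_sumr -sumrB -!big_split/=; apply: eq_bigr => r _; rewrite !mxE; ring.
Qed.

Lemma sqnormZ n (u : 'cV[R]_n) c : sqnorm (c *: u) = c ^+ 2 * sqnorm u.
Proof. by rewrite mulr_sumr; apply: eq_bigr => r _; rewrite mxE exprMn. Qed.

Lemma sqnormD_le n (u v : 'cV[R]_n) : sqnorm (u + v) <= 2 * sqnorm u + 2 * sqnorm v.
Proof. by have := sqnorm_ge0 (u - v); rewrite sqnormB sqnormD; lra. Qed.

Lemma sqnormB_le n (u v : 'cV[R]_n) : sqnorm (u - v) <= 2 * sqnorm u + 2 * sqnorm v.
Proof. by have := sqnorm_ge0 (u + v); rewrite sqnormB sqnormD; lra. Qed.

Lemma sqnorm_trmx_le n m (M : 'M[R]_(m, n)) c v : 0 < c ->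
  (forall x, sqnorm (M *m x) <= c * sqnorm x) -> sqnorm (M^T *m v) <= c * sqnorm v.
Proof.
move=> c0 Mc; set y := M^T *m v; have yE : dotv (M *m y) v = sqnorm y by rewrite -dotv_trmx.
have := sqnorm_ge0 (M *m y - c *: v); rewrite sqnormB dotvZr yE sqnormZ => square_ge0.
by rewrite -(ler_pM2l c0); have := Mc y; move: square_ge0; rewrite expr2; nra.
Qed.

Lemma cvg_sqnorm0 n (x : nat -> 'cV[R]_n) (v : 'cV[R]_n) :
  sqnorm (x k - v) @[k --> \oo] --> (0 : R) -> x k @[k --> \oo] --> v.
Proof.
move=> cx; apply/cvg_ballP => e e0; have e20 : 0 < e ^+ 2 by rewrite exprn_gt0.
have /cvgrPdist_lt/(_ _ e20)[K _ closeK] := cx.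
exists K => // k /closeK/=; rewrite sub0r normrN ger0_norm ?sqnorm_ge0// => lt_e.
split => // i j; rewrite ord1 /ball/= distrC -(ltr_pXn2r (n := 2)) ?nnegrE ?normr_ge0 ?(ltW e0)//.
rewrite real_normK ?num_real//; apply: le_lt_trans lt_e.
by have := sqr_coord_le (x k - v) i; rewrite !mxE.
Qed.

Lemma dotv_phi n k (u : 'cV[R]_n) (r : 'I_n) : (r : nat) = (k.-1 %% n)%N ->
  dotv (phi n k) u = u r 0.
Proof.
move=> rk; rewrite /dotv (bigD1 r)//= mxE rk eqxx mul1r big1 ?addr0// => s sr.
by rewrite mxE -rk; have /negbTE -> : (s : nat) != r by []; rewrite mul0r.
Qed.

Lemma sqr_dotv_phi_le n k (u : 'cV[R]_n) : dotv (phi n k) u ^+ 2 <= sqnorm u.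
Proof.
case: n u => [|n] u; first by rewrite /dotv big_ord0 expr0n sqnorm_ge0.
by rewrite (@dotv_phi _ _ _ (Ordinal (ltn_pmod k.-1 (ltn0Sn n))))// sqr_coord_le.
Qed.

Lemma sqnorm_phi_le1 n k : sqnorm (phi n k : 'cV[R]_n) <= 1.
Proof.
case: n => [|n]; first by rewrite /sqnorm big_ord0.
rewrite -dotvv (@dotv_phi _ _ _ (Ordinal (ltn_pmod k.-1 (ltn0Sn n))))// mxE.
by case: (_ == _).
Qed.

Lemma phi_visits n q k (c : 'I_n) : (0 < k)%N -> (n <= q)%N ->
  exists r : 'I_q, (c : nat) = ((k + r).-1 %% n)%N.
Proof.
move=> k0 nq; have n0 : (0 < n)%N := leq_ltn_trans (leq0n c) (ltn_ord c).
have rq : ((c + (n - k.-1 %% n)) %% n < q)%N by rewrite (leq_trans (ltn_pmod _ n0)).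
exists (Ordinal rq); case: k k0 rq => //= k _ _.
have wrap : ((k + (n - k %% n)) %% n = 0)%N.
  by rewrite -modnDml subnKC ?modnn// ltnW// ltn_pmod.
by rewrite modnDmr addnCA -modnDmr wrap addn0 modn_small.
Qed.

End ColumnVectors.

Section MeasurableColumns.
Context (d : measure_display) (T : measurableType d) (R : realType) (G : set (set T)).
Implicit Types n m : nat.

Definition measurable_col n (f : T -> 'cV[R]_n) := forall r, measurable_wrt G (fun x => f x r 0).

Lemma measurable_colD n (f g : T -> 'cV[R]_n) : measurable_col f -> measurable_col g ->
  measurable_col (fun x => f x + g x).
Proof.
move=> mf mg r; rewrite /measurable_wrt; under eq_fun do rewrite mxE.
by apply: measurable_funD; [exact: mf|exact: mg].
Qed.

Lemma measurable_colB n (f g : T -> 'cV[R]_n) : measurable_col f -> measurable_col g ->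
  measurable_col (fun x => f x - g x).
Proof.
move=> mf mg r; rewrite /measurable_wrt; under eq_fun do rewrite !mxE.
by apply: measurable_funB; [exact: mf|exact: mg].
Qed.

Lemma measurable_colZ n (h : T -> R) (f : T -> 'cV[R]_n) : measurable_wrt G h ->
  measurable_col f -> measurable_col (fun x => h x *: f x).
Proof.
move=> mh mf r; rewrite /measurable_wrt; under eq_fun do rewrite mxE.
by apply: measurable_funM => //; exact: mf.
Qed.

Lemma measurable_col_mulmx n m (A : 'M[R]_(m, n)) (f : T -> 'cV[R]_n) : measurable_col f ->
  measurable_col (fun x => A *m f x).
Proof.
move=> mf r; rewrite /measurable_wrt; under eq_fun do rewrite mxE.
by apply: measurable_sum => s; apply: measurable_funM => //; exact: mf.
Qed.

Lemma measurable_dotv n (u : 'cV[R]_n) (f : T -> 'cV[R]_n) : measurable_col f ->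
  measurable_wrt G (fun x => dotv u (f x)).
Proof. by move=> mf; apply: measurable_sum => r; apply: measurable_funM => //; exact: mf. Qed.

Lemma measurable_sqnorm n (f : T -> 'cV[R]_n) : measurable_col f ->
  measurable_wrt G (fun x => sqnorm (f x)).
Proof. by move=> mf; apply: measurable_sum => r; apply: measurable_funX; exact: mf. Qed.

End MeasurableColumns.

(** * Connectivity and persistent excitation *)

Section Graph.
Context (R : realType) (N : nat) (a : 'M[R]_N).
Context (a_sym : forall i j, a i j = a j i) (a_ge0 : forall i j, 0 <= a i j).
Context (rank_lap : \rank (laplacian a) = N.-1).

Definition dirichlet (x : 'I_N -> R) : R := \sum_i \sum_j a i j * (x i - x j) ^+ 2.

Lemma dirichlet_ge0 x : 0 <= dirichlet x.
Proof. by apply: sum2_ge0 => i j; rewrite mulr_ge0 ?sqr_ge0. Qed.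

Lemma dirichletD_le x y : dirichlet x <= 2 * dirichlet y + 2 * dirichlet (fun i => x i - y i).
Proof.
rewrite /dirichlet !mulr_sumr -big_split/=; apply: ler_sum => i _.
rewrite !mulr_sumr -big_split/=; apply: ler_sum => j _.
have := mulr_ge0 (a_ge0 i j) (sqr_ge0 ((x i - x j) - 2 * (y i - y j))).
by rewrite !expr2; lra.
Qed.

Lemma dirichlet_le x (b : R) : (forall i, x i ^+ 2 <= b) ->
  dirichlet x <= \sum_i \sum_j a i j * 4 * b.
Proof.
move=> xb; apply: ler_sum => i _; apply: ler_sum => j _; rewrite -mulrA ler_wpM2l//.
by have := xb i; have := xb j; have := sqr_ge0 (x i + x j); rewrite !expr2; lra.
Qed.

Lemma edge_weight_eq0 i j : ~~ (0 < a i j) -> a i j = 0.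
Proof. by rewrite -leNgt => a_le0; apply/eqP; rewrite eq_le a_le0 a_ge0. Qed.

Lemma laplacian_ker (u : 'rV[R]_N) :
  (forall i j, 0 < a i j -> u 0 i = u 0 j) -> u *m laplacian a = 0.
Proof.
move=> u_edge; apply/rowP => j; rewrite !mxE.
have degE : \sum_(i | 0 < a j i) a j i = \sum_i a j i.
  by rewrite big_mkcond; apply: eq_bigr => i _; case: ifPn => // /edge_weight_eq0.
under eq_bigr do rewrite mxE mulrBr.
rewrite sumrB (bigD1 j)//= eqxx mul1r degE [X in _ + X - _]big1 ?addr0 => [|i /negbTE ->];
  last by rewrite mul0r mulr0.
rewrite mulr_sumr -sumrB big1// => i _; rewrite (a_sym i j) -mulrBl.
have [/u_edge ->|/edge_weight_eq0 ->] := boolP (0 < a j i); first by rewrite subrr mul0r.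
by rewrite mulr0.
Qed.

Lemma laplacian_connected (i j : 'I_N) : connect (fun k l => 0 < a k l) i j.
Proof.
pose one : 'rV[R]_N := const_mx 1.
pose comp : 'rV[R]_N := \row_k (connect (fun k l => 0 < a k l) i k)%:R.
have N0 : (0 < N)%N by apply: leq_ltn_trans (ltn_ord i).
have one_ker : (one <= kermx (laplacian a))%MS.
  by apply/sub_kermxP/laplacian_ker => k l _; rewrite !mxE.
have comp_ker : (comp <= kermx (laplacian a))%MS.
  apply/sub_kermxP/laplacian_ker => k l kl; rewrite !mxE; congr (_%:R); congr nat_of_bool.
  apply/idP/idP => ik; apply: (connect_trans ik); apply: connect1 => //.
  by rewrite a_sym.
have rank_ker : \rank (kermx (laplacian a)) = 1%N.
  by rewrite mxrank_ker rank_lap -subn1 subKn.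
have one_neq0 : one != 0 by apply/eqP => /rowP/(_ i)/eqP; rewrite !mxE oner_eq0.
have ker_one : (kermx (laplacian a) <= one)%MS.
  by rewrite -(mxrank_leqif_sup one_ker) rank_ker rank_rV one_neq0.
have /sub_rVP[c /rowP compE] := submx_trans comp_ker ker_one.
have := compE j; have := compE i; rewrite !mxE connect0 !mulr1 => <-.
by case: (connect _ i j) => // /eqP; rewrite eq_sym oner_eq0.
Qed.

Let edge_diff_le i j (x : 'I_N -> R) : 0 < a i j -> (x i - x j) ^+ 2 <= (a i j)^-1 * dirichlet x.
Proof.
move=> aij; rewrite ler_pdivlMl//.
have term_ge0 k l : 0 <= a k l * (x k - x l) ^+ 2 by rewrite mulr_ge0 ?sqr_ge0.
apply: le_trans (ler_term_sum j (term_ge0 i)) _.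
by apply: (ler_term_sum (F := fun k => \sum_l _)) => k; apply: sumr_ge0 => l _.
Qed.

Let path_diff_le i j : exists c : R, forall x, (x i - x j) ^+ 2 <= c * dirichlet x.
Proof.
have /connectP[s] := laplacian_connected i j.
elim: s i => [|k s IH] i /=; first by move=> _ ->; exists 0 => x; rewrite subrr expr0n mul0r.
move=> /andP[ik ks] lastj; have [c path_le] := IH k ks lastj.
exists (2 * (a i k)^-1 + 2 * c) => x.
have := edge_diff_le x ik; have := path_le x; have := sqr_ge0 ((x i - x k) - (x k - x j)).
rewrite mulrDl -!mulrA; set u := _ * dirichlet x; set v := _ * dirichlet x.
by rewrite !expr2; nra.
Qed.

Lemma graph_poincare : exists2 c, 0 <= c & forall (x : 'I_N -> R) i j,
  (x i - x j) ^+ 2 <= c * dirichlet x.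
Proof.
have [||c c0 pair_le] := @finite_uniform_bound R ('I_N * 'I_N)%type
  (fun e c => forall x, (x e.1 - x e.2) ^+ 2 <= c * dirichlet x) 0.
- by move=> e c c' cc' ec x; apply: le_trans (ec x) _; rewrite ler_wpM2r ?dirichlet_ge0.
- by move=> [i j]; exact: path_diff_le.
by exists c => // x i j; exact: (pair_le (i, j)).
Qed.

End Graph.

Lemma loewner_excitation (R : realType) (N n p : nat) (m : 'I_N -> nat)
    (H : forall i : 'I_N, nat -> 'M[R]_(m i, n)) (delta : R) (k : nat) (x : 'cV[R]_n) :
  (0 < p)%N ->
  loewner_ge ((p%:R)^-1 *: \sum_(k <= t < k + p) \sum_(i < N) (H i t)^T *m H i t) (delta%:M) ->
  p%:R * delta * sqnorm x <= \sum_(r < p) \sum_i sqnorm (H i (k + r)%N *m x).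
Proof.
move=> p0 /(_ x); rewrite mulmxBr mulmxBl mxE [X in _ + X]mxE subr_ge0.
rewrite mul_mx_scalar -scalemxAl mxE mulmx_dotv -scalemxAr -scalemxAl mxE.
rewrite ler_pdivlMl ?ltr0n// mulrA => /le_trans; apply.
rewrite mulmx_sumr mulmx_suml summxE -{1}[k]add0n big_addn addnC addnK big_mkord.
apply: ler_sum => t _; rewrite mulmx_sumr mulmx_suml summxE; apply: ler_sum => i _.
by rewrite mulmxA -(mulmxA _ _ x) -trmx_mul mulmx_dotv addnC.
Qed.

Section Energy.
Context (R : realType) (N n p : nat) (m : 'I_N -> nat) (a : 'M[R]_N).
Context (a_sym : forall i j, a i j = a j i) (a_ge0 : forall i j, 0 <= a i j).
Context (H : forall i : 'I_N, nat -> 'M[R]_(m i, n)).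
Implicit Types u v : 'I_N -> 'cV[R]_n.

Definition energy (t : nat) u : R :=
  dirichlet a (fun i => dotv (phi n t) (u i)) + \sum_i sqnorm (H i t *m u i).

Lemma observed_energy_ge0 t u : 0 <= \sum_i sqnorm (H i t *m u i).
Proof. by apply: sumr_ge0 => i _; exact: sqnorm_ge0. Qed.

Lemma energy_ge0 t u : 0 <= energy t u.
Proof. by rewrite addr_ge0 ?dirichlet_ge0 ?observed_energy_ge0. Qed.

Lemma energyD_le t u v : energy t u <= 2 * energy t v + 2 * energy t (fun i => u i - v i).
Proof.
rewrite /energy !mulrDr addrACA; apply: lerD.
  have -> : (fun i => dotv (phi n t) (u i - v i)) =
      (fun i => dotv (phi n t) (u i) - dotv (phi n t) (v i)).
    by apply/funext => i; rewrite dotvBr.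
  exact: dirichletD_le.
rewrite !mulr_sumr -big_split/=; apply: ler_sum => i _.
have -> : H i t *m u i = H i t *m v i + H i t *m (u i - v i) by rewrite -mulmxDr subrKC.
exact: sqnormD_le.
Qed.

Context (c : R) (c_gt0 : 0 < c).
Context (H_le : forall i k x, (0 < k)%N -> sqnorm (H i k *m x) <= c * sqnorm x).

Lemma energy_le : exists2 C, 0 <= C & forall t u, (0 < t)%N ->
  energy t u <= C * \sum_i sqnorm (u i).
Proof.
exists (\sum_i \sum_j a i j * 4 + c).
  by rewrite addr_ge0 ?(ltW c_gt0)//; apply: sum2_ge0 => i j; rewrite mulr_ge0.
move=> t u t0; rewrite mulrDl; apply: lerD; last first.
  by rewrite mulr_sumr; apply: ler_sum => i _; exact: H_le.
rewrite mulr_suml; under [leRHS]eq_bigr do rewrite mulr_suml.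
apply: dirichlet_le => // i; apply: le_trans (sqr_dotv_phi_le t (u i)) _.
by apply: (ler_term_sum (F := fun i => sqnorm (u i))) => j; exact: sqnorm_ge0.
Qed.

Lemma sum_coord_dirichlet_le k q u : (0 < k)%N -> (n <= q)%N ->
  \sum_c dirichlet a (fun i => u i c 0) <=
    n%:R * \sum_(r < q) dirichlet a (fun i => dotv (phi n (k + r)) (u i)).
Proof.
move=> k0 nq; rewrite mulr_natl -[X in _ *+ X]card_ord -sumr_const.
apply: ler_sum => l _; have [r lr] := phi_visits l k0 nq.
rewrite (_ : (fun i => u i l 0) = (fun i => dotv (phi n (k + r)) (u i))).
  apply: (ler_term_sum (F := fun r : 'I_q => dirichlet a (fun i => dotv (phi n (k + r)) (u i)))).
  by move=> s; exact: dirichlet_ge0.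
by apply/funext => i; rewrite (dotv_phi _ lr).
Qed.

Context (rank_lap : \rank (laplacian a) = N.-1).
Context (delta : R) (delta_gt0 : 0 < delta).
Context (H_pe : forall k x, (0 < k)%N ->
  delta * sqnorm x <= \sum_(r < p) \sum_i sqnorm (H i (k + r)%N *m x)).

Let window_energy k u : R := \sum_(r < n + p) energy (k + r) u.

Let disagreement_le : exists2 C, 0 <= C & forall k u i j, (0 < k)%N ->
  sqnorm (u i - u j) <= C * window_energy k u.
Proof.
have [C C0 poincare] := graph_poincare a_sym a_ge0 rank_lap.
exists (C * n%:R) => [|k u i j k0]; first by rewrite mulr_ge0.
apply: (@le_trans _ _ (C * \sum_l dirichlet a (fun i => u i l 0))).
  by rewrite mulr_sumr; apply: ler_sum => l _; rewrite !mxE; exact: (poincare (fun i => u i l 0)).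
rewrite -mulrA ler_wpM2l//; apply: le_trans (sum_coord_dirichlet_le u k0 (leq_addr p n)) _.
by rewrite ler_wpM2l//; apply: ler_sum => r _; rewrite lerDl observed_energy_ge0.
Qed.

Let window_observed_le k u :
  \sum_(r < p) \sum_i sqnorm (H i (k + r)%N *m u i) <= window_energy k u.
Proof.
apply: (@le_trans _ _ (\sum_(r < p) energy (k + r) u)).
  by apply: ler_sum => r _; rewrite lerDr dirichlet_ge0.
rewrite /window_energy (big_ord_widen (n + p) (fun r => energy (k + r) u)) ?leq_addl//.
by rewrite big_mkcond; apply: ler_sum => r _; case: ifP; rewrite ?energy_ge0.
Qed.

Lemma energy_coercive : exists2 C, 0 <= C & forall k u, (0 < k)%N ->
  \sum_i sqnorm (u i) <= C * \sum_(r < n + p) energy (k + r) u.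
Proof.
have [C C0 agree] := disagreement_le.
pose C1 := delta^-1 * (2 + p%:R * N%:R * (2 * c * C)).
have C10 : 0 <= C1.
  by rewrite mulr_ge0 ?invr_ge0 ?(ltW delta_gt0)// addr_ge0// !mulr_ge0// ltW.
exists (N%:R * C1) => [|k u k0]; first by rewrite mulr_ge0.
rewrite -[X in _ * X]/(window_energy k u) -mulrA mulr_natl -[X in _ *+ X]card_ord -sumr_const.
apply: ler_sum => j _; rewrite /C1 -[leRHS]mulrA ler_pdivlMl//; apply: le_trans (H_pe (u j) k0) _.
apply: (@le_trans _ _ (\sum_(r < p) \sum_i
    (2 * sqnorm (H i (k + r)%N *m u i) + 2 * c * C * window_energy k u))).
  apply: ler_sum => r _; apply: ler_sum => i _.
  have -> : H i (k + r)%N *m u j = H i (k + r)%N *m u i - H i (k + r)%N *m (u i - u j).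
    by rewrite -mulmxBr subKr.
  apply: le_trans (sqnormB_le _ _) _; rewrite lerD2l -!mulrA ler_wpM2l//.
  apply: le_trans (H_le _ _ _) _; first by rewrite addn_gt0 k0.
  by rewrite ler_wpM2l ?agree// ltW.
under eq_bigr do rewrite big_split/= -mulr_sumr sumr_const card_ord.
rewrite big_split/= -mulr_sumr sumr_const card_ord [leRHS]mulrDl; apply: lerD.
  by rewrite ler_wpM2l ?window_observed_le.
by rewrite -[leLHS]mulr_natl -[X in _ * X <= _]mulr_natl !mulrA.
Qed.

End Energy.

(** * One step of the algorithm *)

Lemma sqnorm_observation_le (R : realType) (n m : nat) (M : 'M[R]_(m, n)) (c : R)
    (u : 'cV[R]_n) (w : 'cV[R]_m) : 0 < c -> (forall x, sqnorm (M *m x) <= c * sqnorm x) ->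
  sqnorm (M^T *m (w - M *m u)) <= 2 * c * sqnorm w + 2 * c ^+ 2 * sqnorm u.
Proof.
move=> c0 Mc; apply: le_trans (sqnorm_trmx_le (w - M *m u) c0 Mc) _.
have := ler_wpM2l (ltW c0) (sqnormB_le w (M *m u)); have := ler_wpM2l (ltW c0) (Mc u).
by rewrite expr2 mulrDr -!mulrA; lra.
Qed.

Lemma norm_ratio_le (R : realFieldType) (y v C : R) : 0 <= v -> 1 <= C -> y ^+ 2 <= C * v ->
  `|y / (1 + v)| <= C.
Proof.
move=> v0 C1 yCv; have v1 : 0 < 1 + v by apply: ltr_pwDl.
rewrite normrM (gtr0_norm (_ : 0 < (1 + v)^-1)) ?invr_gt0// ler_pdivrMr// ler_norml.
by have := sqr_ge0 (y - 1); have := sqr_ge0 (y + 1); move: yCv; rewrite !expr2; nra.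
Qed.

Section SignConsensus.
Context (R : realType) (N n : nat) (m : 'I_N -> nat) (a : 'M[R]_N).
Context (nu b : 'I_N -> 'I_N -> R) (alpha : 'I_N -> 'I_N -> nat -> R) (beta : 'I_N -> nat -> R).
Context (H : forall i : 'I_N, nat -> 'M[R]_(m i, n)) (theta : 'cV[R]_n).
Implicit Types (k : nat) (x : 'I_N -> 'cV[R]_n) (wk : forall i, 'cV[R]_(m i)) (dk : 'I_N -> R).

Definition error x i : 'cV[R]_n := x i - theta.
Definition lyapunov x : R := \sum_i sqnorm (error x i).
Definition probe k x i : R := dotv (phi n k) (x i).
Definition threshold k i j : R := nu i j * b i j * ln k%:R.
Definition mean_bit k i j (z : R) : R := mean_quantized (threshold k i j) (b i j) z.
Definition received k x dk j i : R := quantized (threshold k j i) (probe k x j + b j i * dk j).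
Definition bit_noise k x dk j i : R := received k x dk j i - mean_bit k j i (probe k x j).
Definition gain k i j : R := alpha i j k * a i j.
Definition innovation k x dk i : R :=
  \sum_j gain k i j * (received k x dk j i - mean_bit k i j (probe k x i)).

Context (a_sym : forall i j, a i j = a j i) (a_ge0 : forall i j, 0 <= a i j).
Context (nu_sym : forall i j, 0 < a i j -> nu i j = nu j i).
Context (nu_ge0 : forall i j, 0 < a i j -> 0 <= nu i j).
Context (b_sym : forall i j, 0 < a i j -> b i j = b j i).
Context (b_gt0 : forall i j, 0 < a i j -> 0 < b i j).
Context (alpha_sym : forall i j k, 0 < a i j -> (1 <= k)%N -> alpha i j k = alpha j i k).
Context (alpha_gt0 : forall i j k, 0 < a i j -> (1 <= k)%N -> 0 < alpha i j k).
Context (beta_gt0 : forall i k, (1 <= k)%N -> 0 < beta i k).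
Context (c : R) (c_gt0 : 0 < c).
Context (H_le : forall i k (y : 'cV[R]_n), (0 < k)%N -> sqnorm (H i k *m y) <= c * sqnorm y).

Section OneStep.
Context (k : nat) (k_gt0 : (0 < k)%N).

Lemma threshold_ge0 i j : 0 < a i j -> 0 <= threshold k i j.
Proof.
move=> aij; rewrite mulr_ge0 ?ln_ge0 ?ler1n//.
by rewrite mulr_ge0 ?nu_ge0// ltW ?b_gt0.
Qed.

Lemma gain_sym i j : gain k i j = gain k j i.
Proof.
rewrite /gain; have [aij|/(edge_weight_eq0 a_ge0) aij] := boolP (0 < a i j).
  by rewrite (alpha_sym aij)// a_sym.
by rewrite (a_sym j i) aij !mulr0.
Qed.

Lemma gain_ge0 i j : 0 <= gain k i j.
Proof.
rewrite /gain; have [aij|/(edge_weight_eq0 a_ge0) ->] := boolP (0 < a i j); last by rewrite mulr0.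
by rewrite mulr_ge0 ?ltW ?alpha_gt0.
Qed.

Lemma gain_mean_bit_sym i j z : gain k i j * mean_bit k i j z = gain k i j * mean_bit k j i z.
Proof.
rewrite /gain; have [aij|/(edge_weight_eq0 a_ge0) ->] := boolP (0 < a i j).
  by rewrite /mean_bit /threshold (nu_sym aij) (b_sym aij).
by rewrite mulr0 !mul0r.
Qed.

Lemma probe_error x i : probe k x i = dotv (phi n k) (error x i) + dotv (phi n k) theta.
Proof. by rewrite dotvBr subrK. Qed.

Let step x wk dk := sc_step a nu b alpha beta H theta wk dk k x.

Lemma error_step x wk dk i : error (step x wk dk) i = error x i +
  (innovation k x dk i *: phi n k + beta i k *: ((H i k)^T *m (wk i - H i k *m error x i))).
Proof.
have innovE : innovation k x dk i = \sum_(j | 0 < a i j) alpha i j k * a i j *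
    ((if threshold k j i < `|probe k x j + b j i * dk j|
      then (if 0 < probe k x j + b j i * dk j then 1 else -1) else 0) -
     (lap_cdf ((probe k x i - threshold k i j) / b i j) -
      lap_cdf ((- probe k x i - threshold k i j) / b i j))).
  rewrite [RHS]big_mkcond; apply: eq_bigr => j _.
  by case: ifPn => // /(edge_weight_eq0 a_ge0) aij; rewrite /gain aij mulr0 mul0r.
rewrite /error /step /sc_step; cbv zeta.
rewrite [\sum_(j | _) _](_ : _ = innovation k x dk i); last first.
  by rewrite innovE; under eq_bigr do rewrite !mulmx_dotv.
have -> : H i k *m theta + wk i - H i k *m x i = wk i - H i k *m (x i - theta).
  by rewrite mulmxBr opprB addrA [wk i + _]addrC.
by rewrite -[x i + _ + _]addrA addrAC.
Qed.

Lemma innovation_split x dk i : innovation k x dk i =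
  \sum_j gain k i j * bit_noise k x dk j i +
  \sum_j gain k i j * (mean_bit k i j (probe k x j) - mean_bit k i j (probe k x i)).
Proof.
rewrite -big_split; apply: eq_bigr => j _ /=; rewrite /bit_noise.
rewrite [gain k i j * (_ - mean_bit k j i _)]mulrBr -gain_mean_bit_sym; ring.
Qed.

Lemma sqr_innovation_le x dk i : innovation k x dk i ^+ 2 <= 4 * N%:R * \sum_j gain k i j ^+ 2.
Proof.
apply: le_trans (sqr_sum_le _) _; rewrite -mulrA mulrCA ler_wpM2l//.
rewrite mulr_sumr; apply: ler_sum => j _; rewrite exprMn mulrC ler_wpM2r ?sqr_ge0//.
have := norm_quantized_le1 (threshold k j i) (probe k x j + b j i * dk j).
have := norm_mean_quantized_le1 (threshold k i j) (b i j) (probe k x i).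
rewrite -/(received k x dk j i) -/(mean_bit k i j (probe k x i)) !ler_norml.
move: (received _ _ _ _ _) (mean_bit _ _ _ _) => s g /andP[? ?] /andP[? ?].
by rewrite expr2; nra.
Qed.

Definition edge_dissipation x i j : R := gain k i j * ((probe k x i - probe k x j) *
  (mean_bit k i j (probe k x i) - mean_bit k i j (probe k x j))).

Definition dissipation x : R := \sum_i \sum_j edge_dissipation x i j +
  2 * \sum_i beta i k * sqnorm (H i k *m error x i).

Definition noise_term x wk dk : R :=
  \sum_i \sum_j gain k i j * bit_noise k x dk j i * dotv (phi n k) (error x i) +
  \sum_i beta i k * dotv (H i k *m error x i) (wk i).

Definition perturbation wk : R := 8 * N%:R * \sum_i \sum_j gain k i j ^+ 2 +
  4 * c * \sum_i beta i k ^+ 2 * sqnorm (wk i) + 4 * c ^+ 2 * \sum_i beta i k ^+ 2.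

Lemma edge_dissipation_ge0 x i j : 0 <= edge_dissipation x i j.
Proof.
rewrite /edge_dissipation; have [aij|/(edge_weight_eq0 a_ge0) aij] := boolP (0 < a i j).
  by rewrite mulr_ge0 ?gain_ge0 ?mean_quantized_monotone ?b_gt0 ?threshold_ge0.
by rewrite /gain aij mulr0 mul0r.
Qed.

Lemma dissipation_ge0 x : 0 <= dissipation x.
Proof.
rewrite addr_ge0//; first by apply: sum2_ge0 => i j; exact: edge_dissipation_ge0.
by rewrite mulr_ge0//; apply: sumr_ge0 => i _; rewrite mulr_ge0 ?sqnorm_ge0// ltW ?beta_gt0.
Qed.

Lemma lyapunov_ge0 x : 0 <= lyapunov x.
Proof. by apply: sumr_ge0 => i _; exact: sqnorm_ge0. Qed.

Lemma sqnorm_error_le x i : sqnorm (error x i) <= lyapunov x.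
Proof. by apply: (ler_term_sum (F := fun i => sqnorm (error x i))) => j; exact: sqnorm_ge0. Qed.

Lemma perturbation_ge0 wk : 0 <= perturbation wk.
Proof.
have c0 := ltW c_gt0; rewrite /perturbation !addr_ge0 ?mulr_ge0 ?sqr_ge0//.
- by apply: sum2_ge0 => i j; exact: sqr_ge0.
- by apply: sumr_ge0 => i _; rewrite mulr_ge0 ?sqr_ge0 ?sqnorm_ge0.
- by apply: sumr_ge0 => i _; exact: sqr_ge0.
Qed.

(* Symmetrization over the edges, as for a Dirichlet form. *)
Lemma consensus_dissipation x :
  2 * \sum_i dotv (phi n k) (error x i) * \sum_j gain k i j *
     (mean_bit k i j (probe k x j) - mean_bit k i j (probe k x i)) =
  - \sum_i \sum_j edge_dissipation x i j.
Proof.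
pose F i j := dotv (phi n k) (error x i) * (gain k i j *
  (mean_bit k i j (probe k x j) - mean_bit k i j (probe k x i))).
rewrite (eq_bigr (fun i => \sum_j F i j)) => [|i _]; last by rewrite mulr_sumr.
rewrite mulr2n mulrDl mul1r {2}exchange_big/= -big_split -sumrN/=; apply: eq_bigr => i _.
rewrite -big_split -sumrN/=; apply: eq_bigr => j _.
rewrite /F (gain_sym j i) [gain k i j * (mean_bit k j i _ - _)]mulrBr -!gain_mean_bit_sym.
by rewrite /edge_dissipation !probe_error; ring.
Qed.

Lemma sum_sqnorm_increment_le x wk dk :
  \sum_i sqnorm (innovation k x dk i *: phi n k +
      beta i k *: ((H i k)^T *m (wk i - H i k *m error x i))) <=
  perturbation wk * (1 + lyapunov x).
Proof.
have c0 := ltW c_gt0; apply: (@le_trans _ _ (\sum_i (2 * innovation k x dk i ^+ 2 +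
  4 * c * (beta i k ^+ 2 * sqnorm (wk i)) + 4 * c ^+ 2 * (beta i k ^+ 2 * lyapunov x)))).
  apply: ler_sum => i _; apply: le_trans (sqnormD_le _ _) _; rewrite !sqnormZ.
  have := ler_piMr (sqr_ge0 (innovation k x dk i)) (sqnorm_phi_le1 R n k).
  have := ler_wpM2l (sqr_ge0 (beta i k)) (sqnorm_observation_le (error x i) (wk i) c_gt0
    (fun y => H_le i y k_gt0)).
  have := ler_wpM2l (mulr_ge0 (sqr_ge0 c) (sqr_ge0 (beta i k))) (sqnorm_error_le x i).
  set g := _ ^+ 2; set q := sqnorm (_ *m _); set C2 := c ^+ 2; set B2 := beta i k ^+ 2.
  lra.
rewrite !big_split/= -!mulr_sumr -mulr_suml.
have gain0 : 0 <= \sum_i \sum_j gain k i j ^+ 2 by apply: sum2_ge0 => i j; exact: sqr_ge0.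
have innov_le : \sum_i innovation k x dk i ^+ 2 <= 4 * N%:R * \sum_i \sum_j gain k i j ^+ 2.
  by rewrite mulr_sumr; apply: ler_sum => i _; exact: sqr_innovation_le.
have noise0 : 0 <= \sum_i beta i k ^+ 2 * sqnorm (wk i).
  by apply: sumr_ge0 => i _; rewrite mulr_ge0 ?sqr_ge0 ?sqnorm_ge0.
have beta0 : 0 <= \sum_i beta i k ^+ 2 by apply: sumr_ge0 => i _; exact: sqr_ge0.
have := mulr_ge0 (mulr_ge0 (ler0n R N) gain0) (lyapunov_ge0 x).
have := mulr_ge0 (mulr_ge0 c0 noise0) (lyapunov_ge0 x); have := mulr_ge0 (sqr_ge0 c) beta0.
by move: innov_le; rewrite /perturbation; lra.
Qed.

Lemma sqnorm_error_increment_le x wk dk :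
  \sum_i sqnorm (error (step x wk dk) i - error x i) <= perturbation wk * (1 + lyapunov x).
Proof.
apply: le_trans (sum_sqnorm_increment_le x wk dk); apply: ler_sum => i _.
by rewrite error_step [_ + _ - _]addrAC subrr add0r.
Qed.

Lemma lyapunov_step x wk dk : lyapunov (step x wk dk) <=
  lyapunov x - dissipation x + 2 * noise_term x wk dk + perturbation wk * (1 + lyapunov x).
Proof.
rewrite /lyapunov.
under eq_bigr do rewrite error_step sqnormD dotvDr !dotvZr dotv_trmx dotvBr dotvv.
rewrite big_split/= lerD ?sum_sqnorm_increment_le// big_split/= -addrA lerD2l -mulr_sumr.
have innovE : \sum_i innovation k x dk i * dotv (error x i) (phi n k) =
    \sum_i \sum_j gain k i j * bit_noise k x dk j i * dotv (phi n k) (error x i) +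
    \sum_i dotv (phi n k) (error x i) * \sum_j gain k i j *
      (mean_bit k i j (probe k x j) - mean_bit k i j (probe k x i)).
  rewrite -big_split; apply: eq_bigr => i _ /=.
  by rewrite innovation_split dotvC mulrDl mulr_suml [X in _ + X]mulrC.
rewrite big_split/= innovE; under [X in _ + X]eq_bigr do rewrite mulrBr.
rewrite sumrB /dissipation /noise_term; have := consensus_dissipation x; lra.
Qed.

Definition bit_slope K i j : R := 2^-1 * expR (- (K / b i j)) / b i j.

Lemma edge_dissipation_lb x i j K : 0 < a i j -> (forall l, `|probe k x l| <= K) ->
  bit_slope K i j * (alpha i j k / k%:R `^ nu i j * (a i j * (probe k x i - probe k x j) ^+ 2)) <=
  edge_dissipation x i j.
Proof.
move=> aij xK; have b0 := b_gt0 aij.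
have expE : expR (- ((K + threshold k i j) / b i j)) = expR (- (K / b i j)) / (k%:R `^ nu i j).
  rewrite /powR pnatr_eq0 gtn_eqF// -expRN -expRD; congr expR; rewrite /threshold.
  by field; rewrite gt_eqF.
have := mean_quantized_slope b0 (threshold_ge0 aij) (xK i) (xK j).
rewrite expE => /(ler_wpM2l (gain_ge0 i j)); apply: le_trans.
by rewrite /gain /bit_slope le_eqVlt; apply/orP; left; apply/eqP; ring.
Qed.

End OneStep.

Lemma energy_le_dissipation K : exists2 C, 0 <= C & forall k x z, (0 < k)%N -> 0 <= z ->
  (forall i, `|probe k x i| <= K) ->
  (forall i j, 0 < a i j -> z <= alpha i j k / k%:R `^ nu i j) -> (forall i, z <= beta i k) ->
  z * energy a H k (error x) <= C * dissipation k x.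
Proof.
have [||C C1 slopeC] := @finite_uniform_bound R ('I_N * 'I_N)%type
  (fun e C => 0 < a e.1 e.2 -> (bit_slope K e.1 e.2)^-1 <= C) 1.
- by move=> e C C' CC' eC /eC /le_trans; apply.
- by move=> e; exists (bit_slope K e.1 e.2)^-1.
have C0 : 0 <= C by rewrite (le_trans ler01).
exists C => // k x z k0 z0 xK z_alpha z_beta; rewrite /energy /dissipation !mulrDr; apply: lerD.
  rewrite /dirichlet !mulr_sumr; apply: ler_sum => i _; rewrite !mulr_sumr; apply: ler_sum => j _.
  have [aij|/(edge_weight_eq0 a_ge0) ->] := boolP (0 < a i j); last first.
    by rewrite mul0r mulr0 mulr_ge0 ?edge_dissipation_ge0.
  have s0 : 0 < bit_slope K i j by rewrite divr_gt0 ?b_gt0// mulr_gt0 ?expR_gt0.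
  apply: le_trans (ler_wpM2r (edge_dissipation_ge0 k0 x i j) (slopeC (i, j) aij)).
  rewrite ler_pdivlMl//; apply: le_trans (edge_dissipation_lb k0 aij xK).
  rewrite ler_pM2l// -[dotv _ _ - _](_ : probe k x i - probe k x j = _); last first.
    by rewrite !probe_error; ring.
  by apply: ler_wpM2r; [rewrite mulr_ge0 ?sqr_ge0|exact: z_alpha].
rewrite mulrCA !mulr_sumr; apply: ler_sum => i _.
have := ler_wpM2r (sqnorm_ge0 (H i k *m error x i)) (z_beta i).
have := mulr_ge0 (le_trans z0 (z_beta i)) (sqnorm_ge0 (H i k *m error x i)).
set q := beta i k * _; set zq := z * _ => q0 zq_le.
by have := ler_wpM2r q0 C1; lra.
Qed.

(** * Pathwise convergence *)

Section Trajectory.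
Context (rank_lap : \rank (laplacian a) = N.-1).
Context (p : nat) (delta : R) (delta_gt0 : 0 < delta).
Context (H_pe : forall k (y : 'cV[R]_n), (0 < k)%N ->
  delta * sqnorm y <= \sum_(r < p) \sum_i sqnorm (H i (k + r)%N *m y)).
Context (cvg_gain : forall i j, cvgn (series (fun k => gain k.+1 i j ^+ 2))).
Context (cvg_beta : forall i, cvgn (series (fun k => beta i k.+1 ^+ 2))).
Context (z : nat -> R) (Cz : R) (z_ge0 : forall k, 0 <= z k) (Cz_ge1 : 1 <= Cz).
Context (zS : forall k, z k.+1 <= Cz * z k) (dvg_z : ~ cvgn (series z)).
Context (z_alpha : forall i j k, 0 < a i j -> z k <= alpha i j k.+1 / (k.+1%:R `^ nu i j)).
Context (z_beta : forall i k, z k <= beta i k.+1).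

Context (x : nat -> 'I_N -> 'cV[R]_n) (w : nat -> forall i, 'cV[R]_(m i)) (d : nat -> 'I_N -> R).
Context (xS : forall k, x k.+1 = sc_step a nu b alpha beta H theta (w k) (d k) k.+1 (x k)).
Context (cvg_bit_noise : forall i j, cvgn (series (fun k =>
  gain k.+1 i j * bit_noise k.+1 (x k) (d k) j i *
  (dotv (phi n k.+1) (error (x k) i) / (1 + lyapunov (x k)))))).
Context (cvg_obs_noise : forall i (r : 'I_(m i)), cvgn (series (fun k =>
  beta i k.+1 * w k i r 0 * ((H i k.+1 *m error (x k) i) r 0 / (1 + lyapunov (x k)))))).
Context (cvg_obs_power : forall i, cvgn (series (fun k => beta i k.+1 ^+ 2 * sqnorm (w k i)))).

Let cvg_noise :
  cvgn (series (fun k => 2 * noise_term k.+1 (x k) (w k) (d k) / (1 + lyapunov (x k)))).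
Proof.
have -> : (fun k => 2 * noise_term k.+1 (x k) (w k) (d k) / (1 + lyapunov (x k))) =
  (fun k => 2 * (\sum_i \sum_j gain k.+1 i j * bit_noise k.+1 (x k) (d k) j i *
    (dotv (phi n k.+1) (error (x k) i) / (1 + lyapunov (x k))) +
    \sum_i \sum_r beta i k.+1 * w k i r 0 *
      ((H i k.+1 *m error (x k) i) r 0 / (1 + lyapunov (x k))))).
  apply/funext => k; rewrite -mulrA /noise_term [(_ + _) / (1 + _)]mulrDl !mulr_suml.
  congr (_ * (_ + _)).
    by apply: eq_bigr => i _; rewrite mulr_suml; apply: eq_bigr => j _; rewrite mulrA.
  apply: eq_bigr => i _; rewrite -mulrA mulr_suml mulr_sumr.
  by apply: eq_bigr => r _; ring.
apply: cvg_seriesM; apply: is_cvg_seriesD.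
  by apply: cvg_series_sum => i; exact: cvg_series_sum.
by apply: cvg_series_sum => i; exact: cvg_series_sum.
Qed.

Let cvg_perturbation : cvgn (series (fun k => perturbation k.+1 (w k))).
Proof.
apply: is_cvg_seriesD; first apply: is_cvg_seriesD; apply: cvg_seriesM.
- by apply: cvg_series_sum => i; exact: cvg_series_sum.
- exact: cvg_series_sum.
- exact: cvg_series_sum.
Qed.

Lemma lyapunov_dissipation_cvg : cvgn (fun k => lyapunov (x k)) /\
  cvgn (series (fun k => dissipation k.+1 (x k))).
Proof.
apply: (lyapunov_recursion_cvg _ _ _ cvg_noise cvg_perturbation) => k.
- exact: lyapunov_ge0.
- exact: dissipation_ge0.
- by rewrite xS; exact: lyapunov_step.
Qed.

Let lyapunov_bounded : exists B, forall k, lyapunov (x k) <= B.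
Proof.
have [/cvg_seq_bounded/bounded_fun_has_ubound[B xB] _] := lyapunov_dissipation_cvg.
by exists B => k; apply: xB; exists k.
Qed.

Let probe_bounded : exists K, forall k i, `|probe k.+1 (x k) i| <= K.
Proof.
have [B xB] := lyapunov_bounded; exists (1 + (2 * B + 2 * sqnorm theta)) => k i.
have norm_le (y v : R) : y ^+ 2 <= v -> `|y| <= 1 + v.
  by move=> yv; rewrite ler_norml; have := sqr_ge0 (y - 1); have := sqr_ge0 (y + 1); nra.
apply: norm_le; apply: le_trans (sqr_dotv_phi_le _ _) _.
rewrite -[x k i](subrK theta); apply: le_trans (sqnormD_le _ _) _.
by rewrite lerD2r ler_wpM2l//; exact: le_trans (sqnorm_error_le _ i) (xB k).
Qed.

Let cvg_energy : cvgn (series (fun k => z k * energy a H k.+1 (error (x k)))).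
Proof.
have [K xK] := probe_bounded; have [C C0 energyC] := energy_le_dissipation K.
have [_ cD] := lyapunov_dissipation_cvg.
apply: series_le_cvg (cvg_seriesM (c := C) cD) => k.
- by rewrite mulr_ge0 ?energy_ge0.
- by rewrite mulr_ge0 ?dissipation_ge0.
- by apply: energyC => // i j; exact: z_alpha.
Qed.

Let displacement r k : R := \sum_i sqnorm (error (x k) i - error (x (k + r)%N) i).

Let displacement_ge0 r k : 0 <= displacement r k.
Proof. by apply: sumr_ge0 => i _; exact: sqnorm_ge0. Qed.

Let increment_cvg0 :
  \sum_i sqnorm (error (x k.+1) i - error (x k) i) @[k --> \oo] --> (0 : R).
Proof.
have [B xB] := lyapunov_bounded.
have pert0 : perturbation k.+1 (w k) * (1 + B) @[k --> \oo] --> (0 : R).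
  by rewrite -[X in _ --> X](mul0r (1 + B)); apply: cvgMr_tmp; exact: cvg_series_cvg_0.
apply: (squeeze_cvgr _ (cvg_cst 0) pert0); apply: nearW => k; apply/andP; split.
  by apply: sumr_ge0 => i _; exact: sqnorm_ge0.
rewrite xS; apply: le_trans (sqnorm_error_increment_le _ _ _ _) _ => //.
by rewrite ler_wpM2l ?perturbation_ge0// lerD2l.
Qed.

Let displacement_cvg0 r : displacement r k @[k --> \oo] --> (0 : R).
Proof.
elim: r => [|r IH].
  rewrite (_ : displacement 0%N = cst 0); first exact: cvg_cst.
  apply/funext => k; rewrite /displacement big1// => i _; rewrite addn0 subrr.
  by rewrite /sqnorm big1// => s _; rewrite mxE expr0n.
pose increment k := \sum_i sqnorm (error (x k.+1) i - error (x k) i).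
have upper0 : 2 * displacement r k + 2 * increment (k + r)%N @[k --> \oo] --> (0 : R).
  have incr0 : increment (k + r)%N @[k --> \oo] --> (0 : R).
    by have := increment_cvg0; rewrite -(cvg_shiftn r increment).
  have twice (u : nat -> R) : u k @[k --> \oo] --> (0 : R) -> 2 * u k @[k --> \oo] --> (0 : R).
    by rewrite -[X in _ -> _ --> X](mulr0 2); exact: cvgMl_tmp.
  by rewrite -[X in _ --> X]addr0; apply: cvgD; exact: twice.
apply: (squeeze_cvgr _ (cvg_cst 0) upper0); apply: nearW => k; rewrite displacement_ge0/=.
rewrite !mulr_sumr -big_split; apply: ler_sum => i _ /=; rewrite addnS.
have -> : error (x k) i - error (x (k + r).+1) i = (error (x k) i - error (x (k + r)%N) i) -
    (error (x (k + r).+1) i - error (x (k + r)%N) i).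
  by rewrite [X in _ = _ + X]opprB addrA subrK.
exact: sqnormB_le.
Qed.

Lemma lyapunov_cvg0 : lyapunov (x k) @[k --> \oo] --> (0 : R).
Proof.
have [C1 C10 coercive] := energy_coercive a_sym a_ge0 c_gt0 H_le rank_lap delta_gt0 H_pe.
have [C2 C20 energyC] := energy_le a_ge0 c_gt0 H_le.
pose eta k := 2 * C1 * C2 * \sum_(r < n + p) displacement r k.
have eta0 : eta k @[k --> \oo] --> (0 : R).
  rewrite -[X in _ --> X](mulr0 (2 * C1 * C2)); apply: cvgMl_tmp.
  rewrite -[X in _ --> X](_ : \sum_(r < n + p) (0 : R) = 0); last by rewrite big1.
  by apply: cvg_big => [|r _]; [exact: add_continuous|exact: displacement_cvg0].
have [cV _] := lyapunov_dissipation_cvg.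
suff : limn (fun k => lyapunov (x k)) <= 0.
  move=> lim_le0; have lim_ge0 : 0 <= limn (fun k => lyapunov (x k)).
    by apply: limr_ge => //; apply: nearW => k; exact: lyapunov_ge0.
  by rewrite -[0](le_anti (introT andP (conj lim_le0 lim_ge0))).
apply: (excitation_limit_le0 (E := fun k => energy a H k.+1 (error (x k))) (eta := eta)
  (c := 2 * C1) (q := n + p) _ z_ge0 _ Cz_ge1 zS _ eta0 cV cvg_energy dvg_z).
- by move=> k; exact: energy_ge0.
- by rewrite mulr_ge0.
- move=> k; apply: le_trans (coercive k.+1 _ _) _ => //.
  rewrite /eta [2 * C1]mulrC -!mulrA -mulrDr ler_wpM2l// !mulr_sumr -big_split/=.
  apply: ler_sum => r _; rewrite addSn.
  apply: le_trans (energyD_le a_ge0 _ _ _ (error (x (k + r)%N))) _.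
  by rewrite lerD2l ler_wpM2l// energyC.
Qed.

End Trajectory.

(** * The noise series along the estimates *)

Section AlmostSure.
Context (dsp : measure_display) (Omega : measurableType dsp) (P : probability Omega R).
Context (w : forall i : 'I_N, nat -> Omega -> 'cV[R]_(m i)) (d : 'I_N -> nat -> Omega -> R).
Context (x0 : 'I_N -> 'cV[R]_n).

Let F := noise_filtration w d.
Let est k om : 'I_N -> 'cV[R]_n := sc_est a nu b alpha beta H theta x0 w d k om.
Let noise k om i : 'cV[R]_(m i) := w i k.+1 om.
Let dither k om i : R := d i k.+1 om.

Let measurable_received k j i : measurable_wrt (F k) (fun om => probe k.+1 (est k om) j) ->
  measurable_wrt (F k.+1) (fun om => received k.+1 (est k om) (dither k om) j i).
Proof.
move=> mprobe; apply: measurableT_comp (measurable_quantized _) _; apply: measurable_funD.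
  exact: measurable_wrtS (@noise_filtration_nd _ _ _ _ _ w d k) mprobe.
by apply: measurable_funM => //; exact: measurable_wrt_d.
Qed.

Let measurable_probe k j : measurable_col (F k) (fun om => error (est k om) j) ->
  measurable_wrt (F k) (fun om => probe k.+1 (est k om) j).
Proof.
move=> merr; rewrite /measurable_wrt; under eq_fun do rewrite probe_error.
by apply: measurable_funD => //; exact: measurable_dotv.
Qed.

Lemma measurable_error k i : measurable_col (F k) (fun om => error (est k om) i).
Proof.
elim: k i => [|k IH] i; first by move=> r; exact: (measurable_cst (error x0 i r 0)).
have IHS j : measurable_col (F k.+1) (fun om => error (est k om) j).
  by move=> r; exact: measurable_wrtS (@noise_filtration_nd _ _ _ _ _ w d k) (IH j r).
have mprobe j := measurable_probe (IH j).
have msum j : measurable_wrt (F k.+1) (fun om =>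
    received k.+1 (est k om) (dither k om) j i - mean_bit k.+1 i j (probe k.+1 (est k om) i)).
  apply: measurable_funB; first exact: measurable_received.
  apply: measurableT_comp (measurable_mean_quantized _ _) _.
  exact: measurable_wrtS (@noise_filtration_nd _ _ _ _ _ w d k) (mprobe i).
rewrite (_ : (fun om => _) = (fun om => error (est k om) i +
    (innovation k.+1 (est k om) (dither k om) i *: phi n k.+1 + beta i k.+1 *:
    ((H i k.+1)^T *m (noise k om i - H i k.+1 *m error (est k om) i))))); last first.
  by apply/funext => om; rewrite -error_step.
apply: measurable_colD => //; apply: measurable_colD; apply: measurable_colZ => //.
- by apply: measurable_sum => j; apply: measurable_funM => //; exact: msum.
- by move=> r; exact: measurable_cst.
- exact: measurable_cst.
- apply: measurable_col_mulmx; apply: measurable_colB; last exact: measurable_col_mulmx.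
  by move=> r; exact: measurable_wrt_w.
Qed.

Lemma measurable_lyapunov k : measurable_wrt (F k) (fun om => lyapunov (est k om)).
Proof. by apply: measurable_sum => i; apply: measurable_sqnorm; exact: measurable_error. Qed.

Lemma measurable_bit_noise k j i :
  measurable_wrt (F k.+1) (fun om => bit_noise k.+1 (est k om) (dither k om) j i).
Proof.
have mprobe : measurable_wrt (F k) (fun om => probe k.+1 (est k om) j).
  by apply: measurable_probe; exact: measurable_error.
apply: measurable_funB; first exact: measurable_received.
apply: measurableT_comp (measurable_mean_quantized _ _) _.
exact: measurable_wrtS (@noise_filtration_nd _ _ _ _ _ w d k) mprobe.
Qed.

Lemma measurable_ratio k (f : Omega -> R) : measurable_wrt (F k) f ->
  measurable_wrt (F k) (fun om => f om / (1 + lyapunov (est k om))).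
Proof.
move=> mf; apply: measurable_funM => //; apply: measurable_fun_posV.
  by apply: measurable_funD => //; exact: measurable_lyapunov.
by move=> om; apply: ltr_pwDl => //; exact: lyapunov_ge0.
Qed.

Context (w_meas : forall i k (l : 'I_(m i)), (1 <= k)%N ->
  measurable_fun setT (fun om => w i k om l 0)).
Context (d_meas : forall i k, (1 <= k)%N -> measurable_fun setT (d i k)).
Context (d_lap : forall i k (u : R), (1 <= k)%N -> P [set om | d i k om <= u] = (lap_cdf u)%:E).
Context (d_indep : forall (s : seq ('I_N * nat)) (B : 'I_N -> nat -> set R) (A : set Omega),
  uniq s -> all (fun q => (1 <= q.2)%N) s ->
  (forall i k, measurable (B i k)) -> <<s gen_w_all w >> A ->
  P (A `&` \big[setI/setT]_(q <- s) (d q.1 q.2 @^-1` B q.1 q.2))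
  = (P A * \prod_(q <- s) P (d q.1 q.2 @^-1` B q.1 q.2))%E).
Context (cvg_gain : forall i j, cvgn (series (fun k => gain k.+1 i j ^+ 2))).
Context (cvg_beta : forall i, cvgn (series (fun k => beta i k.+1 ^+ 2))).

Let F_measurable k : F k `<=` measurable.
Proof. exact: noise_filtration_measurable. Qed.

Let F_nd k : <<s F k >> `<=` <<s F k.+1 >>.
Proof. exact: noise_filtration_nd. Qed.

Lemma bit_noise_centered k j i : 0 < a j i ->
  centered_given P (F k) (fun om => bit_noise k.+1 (est k om) (dither k om) j i).
Proof.
move=> aji; apply: dither_centered => //.
- exact: d_meas.
- by move=> u; exact: d_lap.
- by move=> A B; exact: dither_indep.
- by apply: measurable_probe; exact: measurable_error.
- exact: b_gt0.
- exact: threshold_ge0.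
Qed.

Lemma norm_bit_noise_le2 k y dk j i : `|bit_noise k y dk j i| <= 2.
Proof.
rewrite (le_trans (ler_normB _ _))// (_ : 2 = 1 + 1 :> R)// lerD//.
  exact: norm_quantized_le1.
exact: norm_mean_quantized_le1.
Qed.

Lemma ae_cvg_bit_noise : {ae P, forall om i j, cvgn (series (fun k =>
  gain k.+1 i j * bit_noise k.+1 (est k om) (dither k om) j i *
  (dotv (phi n k.+1) (error (est k om) i) / (1 + lyapunov (est k om)))))}.
Proof.
apply: filter_forall => i; apply: filter_forall => j.
have [aij|/(edge_weight_eq0 a_ge0) aij] := boolP (0 < a i j); last first.
  by apply: nearW => om; apply: cvg_series0 => k; rewrite /gain aij mulr0 !mul0r.
have mbit t : measurable_fun setT (fun om => bit_noise t.+1 (est t om) (dither t om) j i).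
  by apply: measurable_wrt_fun (@F_measurable t.+1) _; exact: measurable_bit_noise.
apply: (weighted_martingale_series_cvg (A := fun _ _ => setT) _ F_measurable F_nd _
  (xi := fun t om => bit_noise t.+1 (est t om) (dither t om) j i) _ _ _ (B := fun=> 4) _
  (C := 1)) => //.
- by apply: nearW => om; exists 0%N.
- by move=> _ t; exact: (@measurableT _ (g_sigma_algebraType (F t))).
- by move=> t; exact: measurable_bit_noise.
- by move=> t; apply: (bounded_integrable _ (C := 2)) => // om; exact: norm_bit_noise_le2.
- by move=> t; apply: bit_noise_centered; rewrite a_sym.
- move=> _ t; rewrite -[leRHS]mule1 -(@probability_setT _ _ _ P) -integral_cst//.
  apply: ge0_le_integral => //.
  + by move=> om _; rewrite lee_fin sqr_ge0.
  + by apply/measurable_EFinP; exact: measurable_funX.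
  + move=> om _; rewrite lee_fin -(real_normK (num_real _)) (_ : 4 = 2 ^+ 2 :> R); last by ring.
    by rewrite lerXn2r ?nnegrE// norm_bit_noise_le2.
- by move=> t; apply: measurable_ratio; apply: measurable_dotv; exact: measurable_error.
- move=> t om; apply: norm_ratio_le; rewrite ?lyapunov_ge0// mul1r.
  by apply: le_trans (sqr_dotv_phi_le _ _) _; exact: sqnorm_error_le.
Qed.

Context (A2_mds : forall i k (l : 'I_(m i)), (1 <= k)%N ->
  P.-integrable setT (fun om => (w i k om l 0)%:E) /\
  forall A : set Omega, <<s gen_w w k.-1 `|` gen_d d k.-1 >> A ->
    (\int[P]_(om in A) (w i k om l 0)%:E = 0)%E).
Context (rho : R) (rho_ge2 : 2 <= rho) (M : 'I_N -> nat -> Omega -> \bar R).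
Context (M_meas : forall (i : 'I_N) k (B : set (\bar R)), (1 <= k)%N -> measurable B ->
  <<s gen_w w k.-1 >> (M i k @^-1` B)).
Context (M_int : forall (i : 'I_N) k (A : set Omega), (1 <= k)%N -> <<s gen_w w k.-1 >> A ->
  (\int[P]_(om in A) ((vnorm (w i k om)) `^ rho)%:E = \int[P]_(om in A) M i k om)%E).
Context (M_bounded : {ae P, forall om, exists C : R, forall i k, (1 <= k)%N ->
  (M i k om <= C%:E)%E}).

Let localized i : {ae P, forall om, exists K, forall t, moment_le (M i t.+1) K om}.
Proof.
apply: filterS M_bounded => om [C MC]; exists (Num.truncn C).+1 => t.
by apply: le_trans (MC i t.+1 isT) _; rewrite lee_fin ltW// truncnS_gt.
Qed.

Let localized_F i K t : <<s F t>> (moment_le (M i t.+1) K).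
Proof.
by apply: sub_gen_w_noise; apply: moment_le_g_sigma => B mB; exact: (@M_meas i t.+1).
Qed.

Let localized_measurable i K t : measurable (moment_le (M i t.+1) K).
Proof. exact: sub_g_sigma (@F_measurable t) _ (@localized_F i K t). Qed.

Let measurable_power i t : measurable_fun setT (fun om => sqnorm (noise t om i)).
Proof. by apply: measurable_sum => r; apply: measurable_funX; exact: w_meas. Qed.

Lemma integral_localized_power i K t :
  (\int[P]_(om in moment_le (M i t.+1) K) (sqnorm (noise t om i))%:E <= (1 + K%:R)%:E)%E.
Proof.
under eq_integral do rewrite -sqr_vnorm.
apply: (integral_sqr_moment_le (@gen_w_measurable _ _ _ _ _ w w_meas t)) rho_ge2 _ _ _.
- by move=> B mB; exact: (@M_meas i t.+1).
- rewrite (_ : (fun om => _) = (fun om => sqnorm (noise t om i) `^ 2^-1)).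
    exact: (measurableT_comp (measurable_powR 2^-1)).
  by apply/funext => om; rewrite powR12_sqrt// sqnorm_ge0.
- by move=> om; rewrite sqrtr_ge0.
- by move=> A GA; exact: (@M_int i t.+1).
Qed.

Lemma ae_cvg_obs_power :
  {ae P, forall om i, cvgn (series (fun k => beta i k.+1 ^+ 2 * sqnorm (noise k om i)))}.
Proof.
apply: filter_forall => i.
apply: (localized_ae_series_cvg (@localized i) (B := fun K => 1 + K%:R)) => //.
- by move=> t om; exact: sqnorm_ge0.
- by move=> K t; exact: integral_localized_power.
- by move=> t; exact: sqr_ge0.
Qed.

Lemma ae_cvg_obs_noise : {ae P, forall om i (r : 'I_(m i)), cvgn (series (fun k =>
  beta i k.+1 * noise k om i r 0 *
  ((H i k.+1 *m error (est k om) i) r 0 / (1 + lyapunov (est k om)))))}.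
Proof.
apply: filter_forall => i; apply: filter_forall => r.
have mw t : measurable_fun setT (fun om => noise t om i r 0) by exact: w_meas.
apply: (weighted_martingale_series_cvg (@localized i) F_measurable F_nd (@localized_F i)
  (xi := fun t om => noise t om i r 0) _ _ _ (B := fun K => 1 + K%:R) _ (C := 1 + c)) => //.
- by move=> t; exact: measurable_wrt_w.
- by move=> t; have [] := @A2_mds i t.+1 r isT.
- by move=> t; have [] := @A2_mds i t.+1 r isT.
- move=> K t; apply: le_trans (integral_localized_power i K t).
  apply: (ge0_le_integral P (@localized_measurable i K t)) => //.
  + by move=> om _; rewrite lee_fin sqr_ge0.
  + by apply/measurable_EFinP; apply: measurable_funX; exact: measurable_funS (mw t).
  + by apply/measurable_EFinP; exact: measurable_funS (measurable_power i t).
  + by move=> om _; rewrite lee_fin sqr_coord_le.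
- move=> t; apply: measurable_ratio.
  by apply: measurable_col_mulmx; exact: measurable_error.
- move=> t om; apply: norm_ratio_le; rewrite ?lyapunov_ge0// ?lerDl ?(ltW c_gt0)//.
  apply: le_trans (sqr_coord_le _ _) _; apply: le_trans (H_le _ _ _) _ => //.
  have := sqnorm_error_le (est t om) i; have := lyapunov_ge0 (est t om).
  by have := c_gt0; nra.
Qed.

Context (rank_lap : \rank (laplacian a) = N.-1).
Context (p : nat) (delta : R) (delta_gt0 : 0 < delta).
Context (H_pe : forall k (y : 'cV[R]_n), (0 < k)%N ->
  delta * sqnorm y <= \sum_(r < p) \sum_i sqnorm (H i (k + r)%N *m y)).
Context (z : nat -> R) (Cz : R) (z_ge0 : forall k, 0 <= z k) (Cz_ge1 : 1 <= Cz).
Context (zS : forall k, z k.+1 <= Cz * z k) (dvg_z : ~ cvgn (series z)).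
Context (z_alpha : forall i j k, 0 < a i j -> z k <= alpha i j k.+1 / (k.+1%:R `^ nu i j)).
Context (z_beta : forall i k, z k <= beta i k.+1).

Lemma ae_lyapunov_cvg0 : {ae P, forall om, lyapunov (est k om) @[k --> \oo] --> (0 : R)}.
Proof.
apply: filterS3 ae_cvg_bit_noise ae_cvg_obs_noise ae_cvg_obs_power => om bit_om obs_om power_om.
exact: (lyapunov_cvg0 rank_lap delta_gt0 H_pe cvg_gain cvg_beta z_ge0 Cz_ge1 zS dvg_z z_alpha z_beta
  (fun k => erefl (est k.+1 om)) bit_om obs_om power_om).
Qed.

Lemma ae_est_cvg i : {ae P, forall om, (fun k => est k om i) @ \oo --> theta}.
Proof.
apply: filterS ae_lyapunov_cvg0 => om cV; apply: cvg_sqnorm0.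
apply: (squeeze_cvgr _ (cvg_cst 0) cV); apply: nearW => k.
by rewrite sqnorm_ge0 sqnorm_error_le.
Qed.

End AlmostSure.
End SignConsensus.

(** * Step sizes *)

Lemma finite_uniform_ratio (R : realType) (I : finType) (s : I -> nat -> R) (edge : pred I)
    (C0 : R) :
  (forall i k, edge i -> 0 < s i k.+1) ->
  (forall i, edge i -> exists C, forall k, (1 <= k)%N -> s i k.+1 / s i k <= C) ->
  exists2 C, C0 <= C & forall i k, edge i -> s i k.+2 <= C * s i k.+1.
Proof.
move=> s0 ratio; have [||C C0C ratioC] := @finite_uniform_bound R I
  (fun i C => edge i -> forall k, s i k.+2 <= C * s i k.+1) C0.
- move=> i C C' CC' iC ei k; apply: le_trans (iC ei k) _.
  by rewrite ler_wpM2r// ltW// s0.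
- move=> i; have [/[dup] ei /ratio[C iC]|_] := boolP (edge i); last by exists 0.
  by exists C => _ k; rewrite -ler_pdivrMr ?s0// iC.
- by exists C => // i k ei; exact: ratioC.
Qed.

Section StepSizes.
Context (R : realType) (N : nat) (a : 'M[R]_N) (nu : 'I_N -> 'I_N -> R).
Context (alpha : 'I_N -> 'I_N -> nat -> R) (beta : 'I_N -> nat -> R) (i0 : 'I_N).
Context (nu_ge0 : forall i j, 0 < a i j -> 0 <= nu i j).
Context (alpha_gt0 : forall i j k, 0 < a i j -> (1 <= k)%N -> 0 < alpha i j k).
Context (beta_gt0 : forall i k, (1 <= k)%N -> 0 < beta i k).

Definition min_step k : \bar R := Order.min
  (\big[Order.min/+oo%E]_(i < N) \big[Order.min/+oo%E]_(j < N | (0 < a i j)%R)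
     (alpha i j k / (k%:R `^ nu i j))%R%:E)
  (\big[Order.min/+oo%E]_(i < N) (beta i k)%:E).

Lemma min_step_geP (y : \bar R) k : (y <= min_step k)%E <->
  (forall i j, 0 < a i j -> (y <= (alpha i j k / (k%:R `^ nu i j))%:E)%E) /\
  (forall i, (y <= (beta i k)%:E)%E).
Proof.
rewrite /min_step le_min.
split=> [/andP[/bigmin_geP[_ y_alpha] /bigmin_geP[_ y_beta]]|[y_alpha y_beta]].
  by split=> [i j aij|i]; [have /bigmin_geP[_ ->] := y_alpha i isT|exact: y_beta].
apply/andP; split; apply/bigmin_geP; split=> [|i _]; rewrite ?leey//.
by apply/bigmin_geP; split=> [|j aij]; [exact: leey|exact: y_alpha].
Qed.

Let z k : R := fine (min_step k.+1).

Let min_stepE k : min_step k.+1 = (z k)%:E.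
Proof.
have [_ le_beta] := (min_step_geP _ _).1 (lexx (min_step k.+1)).
rewrite fineK// ge0_fin_numE ?(le_lt_trans (le_beta i0)) ?ltry//.
apply/min_step_geP; split=> [i j aij|i]; rewrite lee_fin ?divr_ge0 ?powR_ge0//.
  by rewrite ltW// alpha_gt0.
by rewrite ltW// beta_gt0.
Qed.

Let z_geP (y : R) k : y <= z k <->
  (forall i j, 0 < a i j -> y <= alpha i j k.+1 / (k.+1%:R `^ nu i j)) /\
  (forall i, y <= beta i k.+1).
Proof.
rewrite -lee_fin -min_stepE; split=> [/min_step_geP[y_alpha y_beta]|[y_alpha y_beta]].
  by split=> [i j /y_alpha|i]; rewrite ?lee_fin// -lee_fin.
by apply/min_step_geP; split=> *; rewrite lee_fin ?y_alpha ?y_beta.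
Qed.

Lemma min_step_sequence :
  (forall i j, 0 < a i j -> exists C, forall k, (1 <= k)%N -> alpha i j k.+1 / alpha i j k <= C) ->
  (forall i, exists C, forall k, (1 <= k)%N -> beta i k.+1 / beta i k <= C) ->
  (\sum_(1 <= k <oo) min_step k = +oo)%E ->
  exists z : nat -> R, [/\ forall k, 0 <= z k,
    forall i j k, 0 < a i j -> z k <= alpha i j k.+1 / (k.+1%:R `^ nu i j),
    forall i k, z k <= beta i k.+1, ~ cvgn (series z) &
    exists2 C, 1 <= C & forall k, z k.+1 <= C * z k].
Proof.
move=> alpha_ratio beta_ratio sum_min.
have [||C1 C1_ge1 alphaC] := @finite_uniform_ratio R ('I_N * 'I_N)%type
  (fun e => alpha e.1 e.2) (fun e => 0 < a e.1 e.2) 1.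
- by move=> e k aij; exact: alpha_gt0.
- by move=> e; exact: alpha_ratio.
have [||C C1C betaC] := @finite_uniform_ratio R 'I_N beta xpredT C1.
- by move=> i k _; exact: beta_gt0.
- by move=> i _; exact: beta_ratio.
have C_ge1 : 1 <= C := le_trans C1_ge1 C1C; have C_gt0 : 0 < C := lt_le_trans ltr01 C_ge1.
exists z; split.
- by move=> k; apply/z_geP; split=> *; rewrite ?divr_ge0 ?powR_ge0// ltW ?alpha_gt0 ?beta_gt0.
- by move=> i j k aij; have [+ _] := (z_geP _ k).1 (lexx _); exact.
- by move=> i k; have [_] := (z_geP _ k).1 (lexx _); exact.
- move=> cz; move: sum_min; rewrite eseries_from1.
  by under eq_eseriesr do rewrite min_stepE; rewrite nneseriesE.
exists C => // k; rewrite mulrC -ler_pdivrMr//.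
have [zS_alpha zS_beta] := (z_geP _ k.+1).1 (lexx _).
apply/z_geP; split=> [i j aij|i]; rewrite ler_pdivrMr//.
  apply: le_trans (zS_alpha i j aij) _; rewrite mulrAC ler_pM ?invr_ge0 ?powR_ge0//.
  - by rewrite ltW ?alpha_gt0.
  - by apply: le_trans (alphaC (i, j) k aij) _; rewrite mulrC ler_wpM2l// ltW// alpha_gt0.
  - by rewrite lef_pV2 ?posrE ?powR_gt0// ge0_ler_powR ?nnegrE ?nu_ge0// ler_nat.
by apply: le_trans (zS_beta i) _; rewrite mulrC; exact: betaC.
Qed.

Lemma cvg_sqr_gain i j : (forall i j, 0 <= a i j) ->
  (0 < a i j -> (\sum_(1 <= k <oo) ((alpha i j k) ^+ 2)%:E < +oo)%E) ->
  cvgn (series (fun k => gain a alpha k.+1 i j ^+ 2)).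
Proof.
move=> a_ge0 sum_alpha.
have [/sum_alpha alpha_lty|/(edge_weight_eq0 a_ge0) aij] := boolP (0 < a i j).
  have := nneseries_from1_cvg (fun k => sqr_ge0 (alpha i j k)) alpha_lty.
  move=> /(cvg_seriesM (c := a i j ^+ 2)).
  by under eq_fun do rewrite mulrC -exprMn.
by apply: cvg_series0 => k; rewrite /gain aij mulr0 expr0n.
Qed.

End StepSizes.

Theorem theorem4p1
  (R : realType) (dsp : measure_display) (Omega : measurableType dsp)
  (P : probability Omega R)
  (N n : nat) (m : 'I_N -> nat)
  (* network *)
  (a : 'M[R]_N)
  (a_sym : forall i j, a i j = a j i)
  (a_ge0 : forall i j, 0 <= a i j)
  (a_noloop : forall i, a i i = 0)
  (* observations and noises *)
  (theta : 'cV[R]_n) (H : forall i : 'I_N, nat -> 'M[R]_(m i, n))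
  (w : forall i : 'I_N, nat -> Omega -> 'cV[R]_(m i))
  (d : 'I_N -> nat -> Omega -> R)
  (* algorithm inputs *)
  (theta0 : 'I_N -> 'cV[R]_n) (nu b : 'I_N -> 'I_N -> R)
  (alpha : 'I_N -> 'I_N -> nat -> R) (beta : 'I_N -> nat -> R)
  (nu_sym : forall i j, 0 < a i j -> nu i j = nu j i)
  (nu_ge0 : forall i j, 0 < a i j -> 0 <= nu i j)
  (b_sym : forall i j, 0 < a i j -> b i j = b j i)
  (b_gt0 : forall i j, 0 < a i j -> 0 < b i j)
  (alpha_sym : forall i j k, 0 < a i j -> (1 <= k)%N -> alpha i j k = alpha j i k)
  (alpha_gt0 : forall i j k, 0 < a i j -> (1 <= k)%N -> 0 < alpha i j k)
  (beta_gt0 : forall i k, (1 <= k)%N -> 0 < beta i k)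
  (* (A1) *)
  (A1_bound : exists Hbar : R, 0 < Hbar /\
     forall i k, (1 <= k)%N -> opnorm_le (H i k) Hbar)
  (A1_pe : exists (p : nat) (delta : R), (0 < p)%N /\ 0 < delta /\
     forall k, (1 <= k)%N ->
       loewner_ge ((p%:R)^-1 *: \sum_(k <= t < k + p) \sum_(i < N) (H i t)^T *m H i t)
                  (delta%:M))
  (* (A2) *)
  (w_meas : forall i k (c : 'I_(m i)), (1 <= k)%N ->
     measurable_fun setT (fun om => w i k om c 0))
  (A2_mds : forall i k (c : 'I_(m i)), (1 <= k)%N ->
     P.-integrable setT (fun om => (w i k om c 0)%:E) /\
     forall A : set Omega, <<s gen_w w k.-1 `|` gen_d d k.-1 >> A ->
       (\int[P]_(om in A) (w i k om c 0)%:E = 0)%E)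
  (A2_moment : exists rho : R, 2 < rho /\
     exists M : 'I_N -> nat -> Omega -> \bar R,
       (* M i k is a version of E[ ||w_{i,k}||^rho | F^w_{k-1} ] *)
       (forall (i : 'I_N) k (B : set (\bar R)), (1 <= k)%N -> measurable B ->
          <<s gen_w w k.-1 >> (M i k @^-1` B)) /\
       (forall (i : 'I_N) k (A : set Omega), (1 <= k)%N -> <<s gen_w w k.-1 >> A ->
          (\int[P]_(om in A) ((vnorm (w i k om)) `^ rho)%:E
           = \int[P]_(om in A) M i k om)%E) /\
       {ae P, forall om, exists C : R, forall i k, (1 <= k)%N -> (M i k om <= C%:E)%E})
  (* (A3) *)
  (A3 : \rank (laplacian a) = N.-1)
  (* (A4) *)
  (d_meas : forall i k, (1 <= k)%N -> measurable_fun setT (d i k))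
  (d_lap : forall i k (x : R), (1 <= k)%N ->
     P [set om | d i k om <= x] = (lap_cdf x)%:E)
  (d_indep : forall (s : seq ('I_N * nat)) (B : 'I_N -> nat -> set R) (A : set Omega),
     uniq s -> all (fun q => (1 <= q.2)%N) s ->
     (forall i k, measurable (B i k)) -> <<s gen_w_all w >> A ->
     P (A `&` \big[setI/setT]_(q <- s) (d q.1 q.2 @^-1` B q.1 q.2))
     = (P A * \prod_(q <- s) P (d q.1 q.2 @^-1` B q.1 q.2))%E)
  (* step sizes *)
  (step_i : forall i j, 0 < a i j ->
     (\sum_(1 <= k <oo) ((alpha i j k) ^+ 2)%:E < +oo)%E /\
     exists C : R, forall k, (1 <= k)%N -> alpha i j k.+1 / alpha i j k <= C)
  (step_ii : forall i,
     (\sum_(1 <= k <oo) ((beta i k) ^+ 2)%:E < +oo)%E /\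
     exists C : R, forall k, (1 <= k)%N -> beta i k.+1 / beta i k <= C)
  (step_iii : (\sum_(1 <= k <oo)
     Order.min
       (\big[Order.min/+oo%E]_(i < N) \big[Order.min/+oo%E]_(j < N | (0 < a i j)%R)
          (alpha i j k / (k%:R `^ nu i j))%R%:E)
       (\big[Order.min/+oo%E]_(i < N) (beta i k)%:E) = +oo)%E) :
  forall i : 'I_N,
    {ae P, forall om,
      (fun k => sc_est a nu b alpha beta H theta theta0 w d k om i) @ \oo --> theta}.
Proof.
have [Hbar [Hbar0 H_opnorm]] := A1_bound; have [p [delta [p0 [delta0 excited]]]] := A1_pe.
have [rho [rho2 [M [M_meas [M_int M_bounded]]]]] := A2_moment => i.
have H_le j k y : (1 <= k)%N -> sqnorm (H j k *m y) <= Hbar ^+ 2 * sqnorm y.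
  by move=> k1; apply: sqnorm_mulmx_le (H_opnorm j k k1); exact: ltW.
have H_pe k y (k1 : (0 < k)%N) := loewner_excitation y p0 (excited k k1).
have cvg_beta j := nneseries_from1_cvg (fun k => sqr_ge0 (beta j k)) (step_ii j).1.
have cvg_gain j l := cvg_sqr_gain a_ge0 (fun e => (step_i j l e).1).
have [z [z0 z_alpha z_beta dvg_z [C C1 zS]]] := min_step_sequence i nu_ge0 alpha_gt0 beta_gt0
  (fun j l e => (step_i j l e).2) (fun j => (step_ii j).2) step_iii.
have pdelta0 : 0 < p%:R * delta by rewrite mulr_gt0 ?ltr0n.
exact: (ae_est_cvg theta a_sym a_ge0 nu_sym nu_ge0 b_sym b_gt0 alpha_sym alpha_gt0 beta_gt0
  (exprn_gt0 2 Hbar0) H_le theta0 w_meas d_meas d_lap d_indep cvg_gain cvg_beta A2_mds (ltW rho2)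
  M_meas M_int M_bounded A3 pdelta0 H_pe z0 C1 zS dvg_z z_alpha z_beta).
Qed.
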